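(* Consider any bounded linear operator $\mathrm{S}_r:\mathbb{H}(\Sigma)'\to\mathbb{H}(\Sigma)'$ and assume that $\sigma_1(\mathrm{S}-\mathrm{S}_r)<\gamma_\star$. Let $\mathbf{p}_n\in\mathbb{H}(\Sigma)'$ be the $n$-th iterate obtained by applying GMRes (with respect to the norm $\|\cdot\|_{\mathrm{T}^{-1}}$) to the preconditioned equation $$(\mathrm{Id}+\Pi\mathrm{S}_r)^{-1}(\mathrm{Id}+\Pi\mathrm{S})\mathbf{p}=(\mathrm{Id}+\Pi\mathrm{S}_r)^{-1}\mathbf{f},$$ and set $\mathbf{r}_n=\mathbf{f}-(\mathrm{Id}+\Pi\mathrm{S})\mathbf{p}_n$. Then $$\frac{\|\mathbf{r}_n\|_{\mathrm{T}^{-1}}}{\|\mathbf{r}_0\|_{\mathrm{T}^{-1}}}\leq\frac{2+\sigma_1(\mathrm{S}-\mathrm{S}_r)}{\gamma_\star-\sigma_1(\mathrm{S}-\mathrm{S}_r)}\prod_{1\le j\le n}\left[\frac{\sigma_j(\mathrm{S}-\mathrm{S}_r)}{\gamma_\star}\Big(1+\frac{\sigma_j(\mathrm{S}-\mathrm{S}_r)}{\gamma_\star}\Big)\Big(1-\frac{\sigma_1(\mathrm{S}-\mathrm{S}_r)}{\gamma_\star}\Big)^{-1}\right].$$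
   Context: Setting: $\Omega\subset\mathbb{R}^d$ is a bounded Lipschitz open set, $\kappa>0$, $\kappa_*\ge 0$, $f\in L^2(\Omega)$, and $\Omega_1,\dots,\Omega_J\subset\Omega$ are pairwise disjoint Lipschitz open subdomains with $\overline{\Omega}=\overline{\Omega}_1\cup\dots\cup\overline{\Omega}_J$; $\Sigma=\partial\Omega_1\cup\dots\cup\partial\Omega_J$. All spaces are complex Hilbert spaces; $\langle\cdot,\cdot\rangle$ is the duality pairing without complex conjugation; for $L:H\to V$ bounded, $L^*:V'\to H'$ is defined by $\langle L(u),p\rangle=\langle u,L^*(p)\rangle$. $H^1(\omega)$ carries the norm $\|v\|_{H^1(\omega)}^2=\|\nabla v\|_{L^2(\omega)}^2+\kappa^2\|v\|_{L^2(\omega)}^2$. Well-posedness (standing assumption): with $a(u,v)=\int_\Omega\nabla u\cdot\nabla\overline v-\kappa^2u\overline v\,dx-i\kappa_*\int_{\partial\Omega}u\overline v\,ds$, one has $\alpha:=\inf_{u\in H^1(\Omega)\setminus\{0\}}\sup_{v\in H^1(\Omega)\setminus\{0\}}\frac{|a(u,v)|}{\|u\|_{H^1(\Omega)}\|v\|_{H^1(\Omega)}}>0$. $\mathbb{H}(\Omega):=H^1(\Omega_1)\times\dots\times H^1(\Omega_J)$ and $\mathbb{H}(\Sigma):=H^{1/2}(\partial\Omega_1)\times\dots\times H^{1/2}(\partial\Omega_J)$, with duals $\mathbb{H}(\Omega)'$, $\mathbb{H}(\Sigma)'$. $\mathrm{B}=\mathrm{diag}(\mathrm{B}_{\Omega_j}):\mathbb{H}(\Omega)\to\mathbb{H}(\Sigma)$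 with $\mathrm{B}_{\Omega_j}$ the Dirichlet trace on $\partial\Omega_j$. $\mathrm{A}=\mathrm{diag}(\mathrm{A}_{\Omega_j}):\mathbb{H}(\Omega)\to\mathbb{H}(\Omega)'$ with $\langle \mathrm{A}_{\Omega_j}(u),v\rangle=\int_{\Omega_j}\nabla u\cdot\nabla v-\kappa^2uv\,dx-i\kappa_*\int_{\partial\Omega\cap\partial\Omega_j}uv\,ds$. $\mathrm{T}_+=\mathrm{diag}(\mathrm{T}_{\Omega_j,+}):\mathbb{H}(\Sigma)\to\mathbb{H}(\Sigma)'$, where $\mathrm{T}_{\Omega_j,+}(\phi|_{\partial\Omega_j})=\mathbf{n}_{\Omega_j}\cdot\nabla\phi|_{\partial\Omega_j}$ for every $\phi\in H^1(\Omega_j)$ with $-\Delta\phi+\kappa^2\phi=0$ in $\Omega_j$ ($\mathbf{n}_{\Omega_j}$ exterior unit normal). The reference norm of $\mathbb{H}(\Sigma)$ is $\langle\mathrm{T}_+(p),\overline p\rangle^{1/2}$. Impedance operator: $\mathrm{T}=\mathrm{diag}(\mathrm{T}_{\Omega_j}):\mathbb{H}(\Sigma)\to\mathbb{H}(\Sigma)'$ is bounded, block-diagonal, self-adjoint positive definite (i.e. $\langle\mathrm{T}(p),\overline q\rangle$ is a Hermitian scalar product), with $\mathrm{T}-\mathrm{T}_+$ compact; its norm is then equivalent to the reference norm. On $\mathbb{H}(\Sigma)'$ set $\|p\|_{\mathrm{T}^{-1}}^2=\langle\mathrm{T}^{-1}(p),\overline p\rangle$. $H^{1/2}(\Sigma):=\{u|_\Sigma:\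 u\in H^1(\Omega)\}$ with the quotient norm, and $\mathrm{R}:H^{1/2}(\Sigma)\to\mathbb{H}(\Sigma)$, $\mathrm{R}(v)=(v|_{\partial\Omega_1},\dots,v|_{\partial\Omega_J})$. Exchange operator $\Pi=2\mathrm{T}\mathrm{R}(\mathrm{R}^*\mathrm{T}\mathrm{R})^{-1}\mathrm{R}^*-\mathrm{Id}$ and scattering operator $\mathrm{S}=2i\mathrm{T}\mathrm{B}(\mathrm{A}-i\mathrm{B}^*\mathrm{T}\mathrm{B})^{-1}\mathrm{B}^*+\mathrm{Id}$, both bounded on $\mathbb{H}(\Sigma)'$ ($\mathrm{A}-i\mathrm{B}^*\mathrm{T}\mathrm{B}$ is boundedly invertible). Right-hand side: $\mathbf{f}=-2i\Pi\mathrm{T}\mathrm{B}(\mathrm{A}-i\mathrm{B}^*\mathrm{T}\mathrm{B})^{-1}\boldsymbol{\ell}$, with $\boldsymbol\ell=(\ell_1,\dots,\ell_J)$, $\langle\ell_j,v\rangle=\int_{\Omega_j}fv\,dx$. Known facts: $\|\Pi\mathbf p\|_{\mathrm{T}^{-1}}=\|\mathbf p\|_{\mathrm{T}^{-1}}$, $\Pi^2=\mathrm{Id}$, $\|\mathrm S\mathbf p\|_{\mathrm{T}^{-1}}\le\|\mathbf p\|_{\mathrm{T}^{-1}}$, and $\mathrm{Id}+\Pi\mathrm{S}$ is invertible with $\gamma_\star:=\inf_{\mathbf{p}\ne0}\|(\mathrm{Id}+\Pi\mathrm{S})\mathbf p\|_{\mathrm{T}^{-1}}/\|\mathbf p\|_{\mathrm{T}^{-1}}=\|(\mathrm{Id}+\Pi\mathrm{S})^{-1}\|^{-1}>0$.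 The condition $\sigma_1(\mathrm{S}-\mathrm{S}_r)<\gamma_\star$ ensures that $\mathrm{Id}+\Pi\mathrm{S}_r$ is invertible. GMRes for $M\mathbf p=\mathbf g$ with initial guess $\mathbf p_0\in\mathbb{H}(\Sigma)'$: the $n$-th iterate $\mathbf p_n$ minimizes $\|\mathbf g-M\mathbf z\|_{\mathrm{T}^{-1}}$ over $\mathbf z\in\mathbf p_0+\mathrm{span}\{M^k(\mathbf g-M\mathbf p_0):0\le k\le n-1\}$. It is assumed that $\mathbf r_0\neq0$. Singular values: $\sigma_j(L)=\inf\{\|L-L_j\|:\mathrm{rank}(L_j)<j\}$, $j\ge1$ (so $\sigma_1(L)=\|L\|$), with operator norms on $\mathbb{H}(\Sigma)'$ induced by $\|\cdot\|_{\mathrm{T}^{-1}}$. *)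

(* Defs.v *)
From HB Require Import structures.
From mathcomp Require Import all_boot all_order all_algebra.
From mathcomp Require Import complex.
From mathcomp Require Import all_classical all_reals all_analysis.

Set Implicit Arguments.
Unset Strict Implicit.
Unset Printing Implicit Defensive.

Import Order.TTheory GRing.Theory Num.Theory.
Import numFieldNormedType.Exports.

Local Open Scope classical_set_scope.
Local Open Scope ring_scope.

Section complex_numbers.
Variable R : realType.

Definition cabs (z : R[i]) : R := complex.Re `|z|.

Lemma cabsE (z : R[i]) : (cabs z)%:C%C = `|z|.
Proof. by rewrite /cabs; case: z => a b; rewrite normc_def. Qed.

Lemma cabs_le (z w : R[i]) : (cabs z <= cabs w) = (`|z| <= `|w|).
Proof. by rewrite -lecR !cabsE. Qed.

Lemma cabs_ge0 (z : R[i]) : 0 <= cabs z.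
Proof. by rewrite -lecR cabsE normr_ge0. Qed.

Lemma cabs0 : cabs 0 = 0.
Proof. by rewrite /cabs normr0. Qed.

Lemma cabsD (z w : R[i]) : cabs (z + w) <= cabs z + cabs w.
Proof. by rewrite -lecR rmorphD /= !cabsE ler_normD. Qed.

Lemma cabsM (z w : R[i]) : cabs (z * w) = cabs z * cabs w.
Proof. by apply: (@complexI R); rewrite rmorphM /= !cabsE normrM. Qed.

Definition sqmod (z : R[i]) : R := complex.Re z ^+ 2 + complex.Im z ^+ 2.

End complex_numbers.

(* Complex inner product spaces with a conjugation. The inner product [dot]    *)
(* is linear in its first argument.                                           *)

Record innerSpace (R : realType) := InnerSpace {
  isort :> lmodType R[i];
  dot : isort -> isort -> R[i];
  conj : isort -> isort;
  dot_linear : forall a x y z, dot (a *: x + y) z = a * dot x z + dot y z;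
  dot_herm : forall x y, dot y x = conjc (dot x y);
  dot_gt0 : forall x, x != 0 -> 0 < dot x x;
  conj_antilinear : forall a x y,
    conj (a *: x + y) = conjc a *: conj x + conj y;
  conjK : forall x, conj (conj x) = x;
  dot_conj : forall x y, dot (conj x) (conj y) = conjc (dot x y)
}.

Section operators.
Variable R : realType.

Definition hnorm (H : innerSpace R) (x : H) : R :=
  Num.sqrt (complex.Re (dot x x)).

Definition hcomplete (H : innerSpace R) : Prop :=
  forall u : nat -> H,
    (forall e : R, 0 < e -> exists N : nat, forall m n : nat,
       (N <= m)%N -> (N <= n)%N -> hnorm (u m - u n) < e) ->
  exists l : H, (fun n => hnorm (u n - l)) @ \oo --> (0 : R).

(* Norms are passed explicitly, because one space carries several of them. *)
Definition bounded_linear (V W : lmodType R[i]) (nV : V -> R) (nW : W -> R)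
    (f : V -> W) : Prop :=
  (forall (a : R[i]) x y, f (a *: x + y) = a *: f x + f y) /\
  (exists M : R, forall x, nW (f x) <= M * nV x).

Definition opnorm (V W : lmodType R[i]) (nV : V -> R) (nW : W -> R)
    (f : V -> W) : R :=
  inf [set M : R | 0 <= M /\ forall x, nW (f x) <= M * nV x].

Record bop (V W : lmodType R[i]) (nV : V -> R) (nW : W -> R) := Bop {
  bfun :> V -> W;
  bopP : bounded_linear nV nW bfun
}.

End operators.

Section dual_space.
Variables (R : realType) (H : innerSpace R).

(* The topological dual consists of the LINEAR bounded functionals, the       *)
(* pairing <l, x> being [l x] (no complex conjugation).                        *)
Definition dual_pred : {pred (H -> R[i])} :=
  fun l => `[< bounded_linear (@hnorm R H) (@cabs R) l >].

Record dual := Dual { dfun :> H -> R[i]; _ : dfun \in dual_pred }.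

HB.instance Definition _ := [isSub for dfun].
HB.instance Definition _ := [Choice of dual by <:].

Lemma hnorm_ge0 (x : H) : 0 <= hnorm x.
Proof. exact: sqrtr_ge0. Qed.

Lemma dual_submod_closed : submod_closed dual_pred.
Proof.
split.
  apply/asboolP; split => [a x y|]; first by rewrite scaler0 addr0.
  by exists 0 => x; rewrite mul0r cabs0.
move=> a l m /asboolP[ll [M lM]] /asboolP[lm [N mN]]; apply/asboolP; split.
  move=> b x y; rewrite !fctE ll lm.
  rewrite scalerDr scalerDr !scalerA (mulrC b a) -!addrA; congr (_ + _).
  by rewrite addrCA.
exists (cabs a * M + N) => x.
rewrite !fctE (le_trans (cabsD _ _))// mulrDl lerD//.
by rewrite cabsM -mulrA ler_wpM2l ?cabs_ge0.
Qed.

HB.instance Definition _ :=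
  GRing.isSubmodClosed.Build _ _ dual_pred dual_submod_closed.
HB.instance Definition _ := [SubChoice_isSubLmodule of dual by <:].

Definition dnorm (l : dual) : R := opnorm (@hnorm R H) (@cabs R) l.

Definition dconj (l : dual) (x : H) : R[i] := conjc (l (conj x)).

End dual_space.

Section adjoint.
Variables (R : realType) (H K : innerSpace R).
Variable L : bop (@hnorm R H) (@hnorm R K).

Lemma adj_subproof (p : dual K) : ((p : K -> R[i]) \o L) \in @dual_pred R H.
Proof.
case: p => p /= /asboolP[lp [M pM]]; have [lL [N LN]] := bopP L.
apply/asboolP; split => [a x y /=|]; first by rewrite lL lp.
exists (`|M| * N) => x /=; apply: (le_trans (pM _)).
rewrite -mulrA; apply: (le_trans (_ : _ <= `|M| * hnorm (L x))).
  by rewrite ler_wpM2r ?hnorm_ge0 ?ler_norm.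
by rewrite ler_wpM2l.
Qed.

Definition adj (p : dual K) : dual H := Dual (adj_subproof p).

End adjoint.

Section hilbert_product.
Variables (R : realType) (I : finType) (V : I -> innerSpace R).

Definition dprod := forall i, V i.

HB.instance Definition _ := gen_eqMixin dprod.
HB.instance Definition _ := gen_choiceMixin dprod.

Let add (x y : dprod) : dprod := fun i => x i + y i.
Let opp (x : dprod) : dprod := fun i => - x i.
Let scale (a : R[i]) (x : dprod) : dprod := fun i => a *: x i.

Let addA : associative add.
Proof. by move=> x y z; apply: functional_extensionality_dep => i; rewrite /add addrA. Qed.
Let addC : commutative add.
Proof. by move=> x y; apply: functional_extensionality_dep => i; rewrite /add addrC. Qed.
Let add0 : left_id (fun i => 0) add.
Proof. by move=> x; apply: functional_extensionality_dep => i; rewrite /add add0r. Qed.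
Let addN : left_inverse (fun i => 0) opp add.
Proof. by move=> x; apply: functional_extensionality_dep => i; rewrite /add addNr. Qed.

HB.instance Definition _ := GRing.isZmodule.Build dprod addA addC add0 addN.

Let scaleA a b v : scale a (scale b v) = scale (a * b) v.
Proof. by apply: functional_extensionality_dep => i; rewrite /scale scalerA. Qed.
Let scale1 : left_id 1 scale.
Proof. by move=> v; apply: functional_extensionality_dep => i; rewrite /scale scale1r. Qed.
Let scaleDr : right_distributive scale +%R.
Proof. by move=> a u v; apply: functional_extensionality_dep => i; exact: scalerDr. Qed.
Let scaleDl v : {morph scale^~ v : a b / a + b}.
Proof. by move=> a b; apply: functional_extensionality_dep => i; exact: scalerDl. Qed.

HB.instance Definition _ := GRing.Zmodule_isLmodule.Build R[i] dprod
  scaleA scale1 scaleDr scaleDl.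

Let pdot (x y : dprod) : R[i] := \sum_i dot (x i) (y i).
Let pconj (x : dprod) : dprod := fun i => conj (x i).

Let pdot_linear a x y z : pdot (a *: x + y) z = a * pdot x z + pdot y z.
Proof.
by rewrite /pdot mulr_sumr -big_split /=; apply: eq_bigr => i _; exact: dot_linear.
Qed.
Let pdot_herm x y : pdot y x = conjc (pdot x y).
Proof.
by rewrite /pdot rmorph_sum /=; apply: eq_bigr => i _; exact: dot_herm.
Qed.
Let dot_ge0 (H : innerSpace R) (x : H) : 0 <= dot x x.
Proof.
have [->|x0] := eqVneq x 0; last exact/ltW/dot_gt0.
suff -> : dot (0 : H) (0 : H) = 0 by [].
have := dot_linear 1 (0 : H) 0 0.
by rewrite scaler0 add0r mul1r => /esym /eqP; rewrite -subr_eq0 addrK => /eqP.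
Qed.
Let pdot_gt0 x : x != 0 -> 0 < pdot x x.
Proof.
move=> x0; have [i xi] : exists i, x i != 0.
  apply: contrapT => h; move/eqP: x0; apply; apply: functional_extensionality_dep => i.
  by apply/eqP/negPn/negP => xi; apply: h; exists i.
by rewrite /pdot (bigD1 i) //= ltr_wpDr ?dot_gt0// sumr_ge0 // => j _; exact: dot_ge0.
Qed.
Let pconj_antilinear a x y : pconj (a *: x + y) = conjc a *: pconj x + pconj y.
Proof. by apply: functional_extensionality_dep => i; exact: conj_antilinear. Qed.
Let pconjK x : pconj (pconj x) = x.
Proof. by apply: functional_extensionality_dep => i; exact: conjK. Qed.
Let pdot_conj x y : pdot (pconj x) (pconj y) = conjc (pdot x y).
Proof.
by rewrite /pdot rmorph_sum /=; apply: eq_bigr => i _; exact: dot_conj.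
Qed.

Definition hprod : innerSpace R := InnerSpace pdot_linear pdot_herm pdot_gt0
  pconj_antilinear pconjK pdot_conj.

End hilbert_product.

(* Lebesgue and Hausdorff measures on R^d, as Caratheodory measures.          *)

Section outer_measures.
Variable R : realType.

Definition edot d (x y : 'rV[R]_d) : R := \sum_i x ord0 i * y ord0 i.
Definition enorm d (x : 'rV[R]_d) : R := Num.sqrt (edot x x).

Section method_one.
Variables (T : pointedType) (c : set T -> \bar R).
Hypotheses (c0 : c set0 = 0%E) (c_ge0 : forall A, (0 <= c A)%E).

(* inf { sum_k c (F k) : A included in the union of the F k }: the library's  *)
(* [mu_ext], with every set allowed as a covering set.                         *)
Definition cover_outer : set T -> \bar R :=
  @mu_ext _ (g_sigma_algebraType [set: set T]) R c.

Lemma cover_outer0 : cover_outer set0 = 0%E.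
Proof. exact: (@mu_ext0 _ (g_sigma_algebraType [set: set T]) R c c0 c_ge0). Qed.
Lemma cover_outer_ge0 A : (0 <= cover_outer A)%E.
Proof. exact: (@mu_ext_ge0 _ (g_sigma_algebraType [set: set T]) R c c_ge0). Qed.
Lemma le_cover_outer : {homo cover_outer : A B / A `<=` B >-> (A <= B)%E}.
Proof. exact: (@le_mu_ext _ (g_sigma_algebraType [set: set T]) R c). Qed.
Lemma cover_outer_sigma_subadditive : sigma_subadditive cover_outer.
Proof.
exact: (@mu_ext_sigma_subadditive _ (g_sigma_algebraType [set: set T]) R c c_ge0).
Qed.
End method_one.

Section lebesgue.
Variable d : nat.
Notation E := 'rV[R]_d.

Definition box (a b : E) : set E :=
  [set x | forall i, a ord0 i <= x ord0 i <= b ord0 i].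

Definition box_content (A : set E) : \bar R :=
  if `[< A = set0 >] then 0%E else
  ereal_inf [set (\prod_i Num.max 0 (p.2 ord0 i - p.1 ord0 i))%:E
            | p in [set p : E * E | A `<=` box p.1 p.2]].

Lemma box_content0 : box_content set0 = 0%E.
Proof. by rewrite /box_content asboolT. Qed.
Lemma box_content_ge0 A : (0 <= box_content A)%E.
Proof.
rewrite /box_content; case: ifP => // _; apply: le_ereal_inf_tmp => _ [p _ <-].
by rewrite lee_fin prodr_ge0 // => i _; rewrite le_max lexx.
Qed.

Definition leb : set E -> \bar R := cover_outer box_content.

HB.instance Definition _ := isOuterMeasure.Build R E leb
  (cover_outer0 box_content0 box_content_ge0) (cover_outer_ge0 box_content_ge0)
  (@le_cover_outer E box_content)
  (cover_outer_sigma_subadditive box_content_ge0).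

End lebesgue.

Section hausdorff.
Variables (d s : nat).
Notation E := 'rV[R]_d.

Definition ediam (A : set E) : \bar R :=
  ereal_sup [set (enorm (p.1 - p.2))%:E | p in A `*` A].

(* volume of the unit ball of R^s divided by 2^s *)
Definition haus_cst : R :=
  fine (leb [set x : 'rV[R]_s | enorm x <= 1]) / 2 ^+ s.

Definition haus_content (e : R) (A : set E) : \bar R :=
  if `[< A = set0 >] then 0%E else
  if (ediam A <= e%:E)%E then (haus_cst%:E * ediam A ^+ s)%E else +oo%E.

Lemma haus_content0 e : haus_content e set0 = 0%E.
Proof. by rewrite /haus_content asboolT. Qed.
Lemma haus_content_ge0 e A : (0 <= haus_content e A)%E.
Proof.
rewrite /haus_content; case: ifP => // /asboolPn A0; case: ifP => // _.
rewrite mule_ge0// ?expe_ge0//.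
  by rewrite lee_fin divr_ge0 ?exprn_ge0 // fine_ge0 // outer_measure_ge0.
have /set0P[x Ax] : A != set0 by apply/eqP.
apply: (@le_trans _ _ (enorm (x - x))%:E); first by rewrite lee_fin sqrtr_ge0.
by apply: ereal_sup_ubound; exists (x, x).
Qed.

Definition haus (A : set E) : \bar R :=
  ereal_sup [set cover_outer (haus_content e) A | e in [set e : R | 0 < e]].

Lemma haus0 : haus set0 = 0%E.
Proof.
rewrite /haus (_ : [set _ | _ in _] = [set 0%E]) ?ereal_sup1//.
apply/seteqP; split => [_ [e _ <-]|_ ->] /=.
  by rewrite cover_outer0//; [exact: haus_content0|exact: haus_content_ge0].
exists 1 => //=; rewrite cover_outer0//.
  exact: haus_content0.
exact: haus_content_ge0.
Qed.
Lemma haus_ge0 A : (0 <= haus A)%E.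
Proof.
apply: (@le_trans _ _ (cover_outer (haus_content 1) A)).
  exact/cover_outer_ge0/haus_content_ge0.
by apply: ereal_sup_ubound; exists 1 => //=.
Qed.
Lemma le_haus : {homo haus : A B / A `<=` B >-> (A <= B)%E}.
Proof.
move=> A B AB; apply: ge_ereal_sup => _ [e e0 <-].
apply: (@le_trans _ _ (cover_outer (haus_content e) B)).
  exact: le_cover_outer.
by apply: ereal_sup_ubound; exists e.
Qed.
Lemma haus_sigma_subadditive : sigma_subadditive haus.
Proof.
move=> F; apply: ge_ereal_sup => _ [e e0 <-].
apply: le_trans (cover_outer_sigma_subadditive (haus_content_ge0 e) F) _.
apply: lee_nneseries => [k _ _|k _]; first exact/cover_outer_ge0/haus_content_ge0.
by apply: ereal_sup_ubound; exists e.
Qed.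

HB.instance Definition _ := isOuterMeasure.Build R E haus
  haus0 haus_ge0 le_haus haus_sigma_subadditive.

End hausdorff.
End outer_measures.

Section sobolev.
Variables (R : realType) (d : nat).
Notation C := R[i].
Notation E := 'rV[R]_d.
Implicit Types (w D : set E) (u v g : E -> C).

Definition leb_outer : {outer_measure set E -> \bar R} := @leb R d.
Definition mu_vol : {measure set (caratheodory_type leb_outer) -> \bar R} :=
  leb_outer.

(* The (d-1)-dimensional Hausdorff measure is the surface measure [ds].       *)
Definition haus_outer : {outer_measure set E -> \bar R} := @haus R d d.-1.
Definition mu_surf : {measure set (caratheodory_type haus_outer) -> \bar R} :=
  haus_outer.

Definition cint dd (T : measurableType dd) (mu : {measure set T -> \bar R})
    (D : set T) (f : T -> C) : C :=
  Complex (\int[mu]_(x in D) complex.Re (f x))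
          (\int[mu]_(x in D) complex.Im (f x)).

Definition vint D (f : E -> C) : C := cint mu_vol D f.
Definition sint D (f : E -> C) : C := cint mu_surf D f.

Definition L2norm2 dd (T : measurableType dd) (mu : {measure set T -> \bar R})
    (D : set T) (f : T -> C) : \bar R :=
  (\int[mu]_(x in D) (sqmod (f x))%:E)%E.

Definition L2 dd (T : measurableType dd) (mu : {measure set T -> \bar R})
    (D : set T) (f : T -> C) : Prop :=
  [/\ measurable_fun D (fun x => complex.Re (f x)),
      measurable_fun D (fun x => complex.Im (f x)) &
      (L2norm2 mu D f < +oo)%E].

Definition bdry (w : set E) : set E := closure w `\` interior w.

(* Near each boundary point, w is the strict epigraph, in the direction of a  *)
(* unit vector e, of a Lipschitz function h of the component orthogonal to e. *)
Definition lipschitz_open (w : set E) : Prop :=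
  open w /\
  forall x, bdry w x -> exists (e : E) (h : E -> R) (r L : R),
    [/\ enorm e = 1, 0 < r,
        (forall y z, `|h y - h z| <= L * enorm (y - z)) &
        forall y, enorm (y - x) < r ->
          (w y <-> h (y - edot y e *: e) < edot y e)].

Definition pder (i : 'I_d) (f : E -> R) : E -> R :=
  fun x => 'D_(delta_mx ord0 i) f x.

Definition smooth (f : E -> R) : Prop :=
  forall s : seq 'I_d, continuous (foldr pder f s) /\
    forall i x, derivable (foldr pder f s) x (delta_mx ord0 i).

Definition test_fun w (f : E -> R) : Prop :=
  smooth f /\ exists K : set E,
    [/\ compact K, K `<=` w & forall x, ~ K x -> f x = 0].

(* [sobolev w u gu]: u is in H^1(w), with weak gradient gu. *)
Definition sobolev w u (gu : 'I_d -> E -> C) : Prop :=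
  L2 mu_vol w u /\
  forall i, L2 mu_vol w (gu i) /\
    forall f, test_fun w f ->
      vint w (fun x => u x * (pder i f x)%:C%C) =
      - vint w (fun x => gu i x * (f x)%:C%C).

Definition inH1 w u : Prop := exists gu, sobolev w u gu.

Definition csmooth (f : E -> C) : Prop :=
  smooth (fun x => complex.Re (f x)) /\ smooth (fun x => complex.Im (f x)).

Definition cpder (i : 'I_d) (f : E -> C) : E -> C := fun x =>
  Complex (pder i (fun y => complex.Re (f y)) x)
          (pder i (fun y => complex.Im (f y)) x).

(* The Dirichlet trace of H^1(w) is the extension by continuity of the        *)
(* restriction to the boundary: g is the trace of u if some smooth functions   *)
(* tend to u in H^1(w), while their restrictions tend to g in L^2(bdry w).     *)
Definition is_trace w u g : Prop :=
  L2 mu_surf (bdry w) g /\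
  exists (f : nat -> E -> C) (gu : 'I_d -> E -> C),
    [/\ (forall n, csmooth (f n)), sobolev w u gu,
        (fun n => L2norm2 mu_vol w (f n \- u)) @ \oo --> 0%E,
        (forall i, (fun n => L2norm2 mu_vol w (cpder i (f n) \- gu i))
                     @ \oo --> 0%E) &
        (fun n => L2norm2 mu_surf (bdry w) (f n \- g)) @ \oo --> 0%E].

Definition cjf u : E -> C := fun x => conjc (u x).

Definition cvec_dot (a b : 'I_d -> E -> C) (x : E) : C := \sum_i a i x * b i x.

Section spaces.
Variable kappa : R.

(* A model of the Hilbert space H^1(w): an inner product space with the map    *)
(* [h1_cl] sending a function to its class modulo equality almost everywhere.  *)
(* The inner product is the one of the norm                                    *)
(* |grad u|^2_(L^2(w)) + kappa^2 |u|^2_(L^2(w)).                               *)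
Record H1_space (w : set E) := H1Space {
  h1 :> innerSpace R;
  h1_complete : hcomplete h1;
  h1_cl : (E -> C) -> h1;
  h1_cl_onto : forall x : h1, exists u, inH1 w u /\ h1_cl u = x;
  h1_cl_linear : forall (a : C) u v, inH1 w u -> inH1 w v ->
    h1_cl (a *: u + v) = a *: h1_cl u + h1_cl v;
  h1_cl_conj : forall u, inH1 w u -> h1_cl (cjf u) = conj (h1_cl u);
  h1_cl_dot : forall u gu v gv, sobolev w u gu -> sobolev w v gv ->
    dot (h1_cl u) (h1_cl v) =
    vint w (fun x => cvec_dot gu (fun i => cjf (gv i)) x
                     + (kappa ^+ 2)%:C%C * u x * conjc (v x))
}.

(* - Delta u + kappa^2 u = 0 in w, for u in H^1(w) with weak gradient gu *)
Definition modified_helmholtz w u (gu : 'I_d -> E -> C) : Prop :=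
  forall f, test_fun w f ->
    vint w (fun x => cvec_dot gu (fun i y => (pder i f y)%:C%C) x
                     + (kappa ^+ 2)%:C%C * u x * (f x)%:C%C) = 0.

Definition inH12 w g : Prop := exists u, inH1 w u /\ is_trace w u g.

(* A model of H^{1/2}(bdry w): classes, modulo equality almost everywhere on   *)
(* the boundary, of traces of elements of H^1(w). The field [h12_dtn] is the   *)
(* operator T_{w,+}: for u with - Delta u + kappa^2 u = 0 in w, Green's formula *)
(* < n.grad u, v > = int_w grad u . grad v + (Delta u) v  defines the normal    *)
(* derivative, and Delta u = kappa^2 u. It gives the reference inner product.   *)
Record H12_space (w : set E) (V : H1_space w) := H12Space {
  h12 :> innerSpace R;
  h12_complete : hcomplete h12;
  h12_cl : (E -> C) -> h12;
  h12_cl_onto : forall p : h12, exists g, inH12 w g /\ h12_cl g = p;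
  h12_cl_linear : forall (a : C) g g', inH12 w g -> inH12 w g' ->
    h12_cl (a *: g + g') = a *: h12_cl g + h12_cl g';
  h12_cl_conj : forall g, inH12 w g -> h12_cl (cjf g) = conj (h12_cl g);
  h12_cl_eq : forall g g', inH12 w g -> inH12 w g' ->
    (h12_cl g = h12_cl g' <->
     mu_surf [set x | bdry w x /\ g x <> g' x] = 0%E);
  h12_trace : bop (@hnorm R V) (@hnorm R h12);
  h12_traceP : forall u g, inH1 w u -> inH12 w g ->
    (h12_trace (h1_cl V u) = h12_cl g <-> is_trace w u g);
  h12_dtn : bop (@hnorm R h12) (@dnorm R h12);
  h12_dtnP : forall u gu, sobolev w u gu -> modified_helmholtz w u gu ->
    forall v gv, sobolev w v gv ->
    h12_dtn (h12_trace (h1_cl V u)) (h12_trace (h1_cl V v)) =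
    vint w (fun x => cvec_dot gu gv x + (kappa ^+ 2)%:C%C * u x * v x);
  h12_dotE : forall p q : h12, dot p q = h12_dtn p (conj q)
}.

Section skeleton.
Variables (J : nat) (W : set E) (w : 'I_J -> set E) (V : H1_space W).

Definition skeleton : set E := \bigcup_j bdry (w j).

Definition is_skeleton_trace u g : Prop := forall j, is_trace (w j) u g.

Definition inH12_skeleton g : Prop :=
  exists u, inH1 W u /\ is_skeleton_trace u g.

(* A model of H^{1/2}(Sigma), with the quotient norm. *)
Record H12_skeleton := H12Skeleton {
  sk :> innerSpace R;
  sk_complete : hcomplete sk;
  sk_cl : (E -> C) -> sk;
  sk_cl_onto : forall p : sk, exists g, inH12_skeleton g /\ sk_cl g = p;
  sk_cl_linear : forall (a : C) g g', inH12_skeleton g -> inH12_skeleton g' ->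
    sk_cl (a *: g + g') = a *: sk_cl g + sk_cl g';
  sk_cl_conj : forall g, inH12_skeleton g -> sk_cl (cjf g) = conj (sk_cl g);
  sk_cl_eq : forall g g', inH12_skeleton g -> inH12_skeleton g' ->
    (sk_cl g = sk_cl g' <->
     mu_surf [set x | skeleton x /\ g x <> g' x] = 0%E);
  sk_norm : forall g, inH12_skeleton g ->
    hnorm (sk_cl g) =
    inf [set hnorm (h1_cl V u) | u in
           [set u | inH1 W u /\ is_skeleton_trace u g]]
}.

End skeleton.

Variable kappas : R.

(* int_w grad u . grad v - kappa^2 u v dx - i kappas int_S u v ds, where tu    *)
(* and tv are the traces of u and v                                            *)
Definition helmholtz_form w (S : set E) u gu tu v gv tv : C :=
  vint w (fun x => cvec_dot gu gv x - (kappa ^+ 2)%:C%C * u x * v x)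
  - 'i%C * kappas%:C%C * sint S (fun x => tu x * tv x).

(* The form a of the global problem on H^1(W), and its inf-sup constant. *)
Definition is_global_form W (V : H1_space W) (a : V -> V -> C) : Prop :=
  forall u gu tu v gv tv,
    sobolev W u gu -> sobolev W v gv -> is_trace W u tu -> is_trace W v tv ->
    a (h1_cl V u) (h1_cl V v) =
    helmholtz_form W (bdry W) u gu tu
      (cjf v) (fun i => cjf (gv i)) (cjf tv).

End spaces.

Definition inf_sup (V : innerSpace R) (a : V -> V -> C) : \bar R :=
  ereal_inf [set ereal_sup [set (cabs (a u v) / (hnorm u * hnorm v))%:E
                           | v in [set v | v != 0]]
            | u in [set u | u != 0]].

End sobolev.

Section abstract_operators.
Variable R : realType.
Notation C := R[i].

(* The inverse of f when f is bijective. *)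
Definition op_inv (V W : lmodType C) (f : V -> W) : W -> V :=
  fun y => xget 0 [set x | f x = y].

Definition boundedly_invertible (V W : lmodType C) (nV : V -> R) (nW : W -> R)
    (f : V -> W) : Prop :=
  bijective f /\ bounded_linear nW nV (op_inv f).

Definition compact_op (H K : innerSpace R) (L : H -> dual K) : Prop :=
  forall x : nat -> H, (exists M : R, forall n, hnorm (x n) <= M) ->
  exists (k : nat -> nat) (l : dual K),
    (forall m n, (m < n)%N -> (k m < k n)%N) /\
    (fun n => dnorm (L (x (k n)) - l)) @ \oo --> (0 : R).

Definition block_diagonal (I : finType) (V : I -> innerSpace R)
    (T : hprod V -> dual (hprod V)) : Prop :=
  exists Tj : forall j, V j -> dual (V j),
    forall p q : hprod V, T p q = \sum_j Tj j (p j) (q j).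

Definition self_adjoint (H : innerSpace R) (T : H -> dual H) : Prop :=
  forall p q, T p (conj q) = conjc (T q (conj p)).

Definition positive_definite (H : innerSpace R) (T : H -> dual H) : Prop :=
  forall p, p != 0 -> 0 < T p (conj p).

Section scattering.
Variables (HO HS HSk : innerSpace R).
Variables (A : HO -> dual HO) (B : bop (@hnorm R HO) (@hnorm R HS)).
Variables (T : HS -> dual HS) (Rr : bop (@hnorm R HSk) (@hnorm R HS)).

(* |p|_{T^{-1}} = < T^{-1} p, conj p >^{1/2} *)
Definition Tinv_norm (p : dual HS) : R :=
  Num.sqrt (complex.Re (dconj p (op_inv T p))).

Definition RTR : HSk -> dual HSk := fun v => adj Rr (T (Rr v)).

Definition exchange (p : dual HS) : dual HS :=
  2 *: T (Rr (op_inv RTR (adj Rr p))) - p.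

Definition AiBTB : HO -> dual HO := fun u => A u - 'i%C *: adj B (T (B u)).

Definition scatter (p : dual HS) : dual HS :=
  (2 * 'i%C) *: T (B (op_inv AiBTB (adj B p))) + p.

Definition rhs (l : dual HO) : dual HS :=
  - (2 * 'i%C) *: exchange (T (B (op_inv AiBTB l))).

(* Id + Pi S *)
Definition Id_plus_Pi (S : dual HS -> dual HS) (p : dual HS) : dual HS :=
  p + exchange (S p).

End scattering.

Section normed_operators.
Variables (V : lmodType C) (nrm : V -> R).

Definition rank_lt (j : nat) (L : V -> V) : Prop :=
  exists m (e : 'I_m -> V), (m < j)%N /\
    forall x, exists c : 'I_m -> C, L x = \sum_k c k *: e k.

Definition singular_value (j : nat) (L : V -> V) : R :=
  inf [set opnorm nrm nrm (fun x => L x - L' x)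
      | L' in [set L' | bounded_linear nrm nrm L' /\ rank_lt j L']].

Definition lower_bound (L : V -> V) : R :=
  inf [set nrm (L p) / nrm p | p in [set p | p != 0]].

Definition in_krylov (M : V -> V) (r : V) (n : nat) (z : V) : Prop :=
  exists c : 'I_n -> C, z = \sum_k c k *: iter k M r.

Definition is_gmres_iterate (M : V -> V) (g p0 : V) (n : nat) (p : V) : Prop :=
  in_krylov M (g - M p0) n (p - p0) /\
  forall z, in_krylov M (g - M p0) n (z - p0) -> nrm (g - M p) <= nrm (g - M z).

End normed_operators.
End abstract_operators.

(* Main.v *)
Require Import Defs.
From mathcomp Require Import all_boot all_order all_algebra.
From mathcomp Require Import complex.
From mathcomp Require Import all_classical all_reals all_analysis.
From mathcomp Require Import ring lra.

Set Implicit Arguments.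
Unset Strict Implicit.
Unset Printing Implicit Defensive.

Import Order.TTheory GRing.Theory Num.Theory.
Import numFieldNormedType.Exports.

Local Open Scope classical_set_scope.
Local Open Scope ring_scope.

(** On the Hilbert space of dual traces with the scalar product of the norm
    T^-1, put D = S - S_r, G = Id + Pi S, G_r = Id + Pi S_r and
    M = G_r^-1 G.  Since Pi is an isometry and |G p| >= gamma |p|, the
    hypothesis |D| < gamma makes G_r = G - Pi D bijective (Neumann series,
    [neumann_surjective]), with
    |G_r^-1| <= 1 / (gamma - sigma_1).  Moreover
      M - Id = G_r^-1 Pi D    and    M^-1 - Id = - G^-1 Pi D,
    so that the singular values satisfy
      sigma_j(M - Id) <= sigma_j(D) / (gamma - sigma_1)  and
      sigma_j(M^-1) <= 1 + sigma_j(D) / gamma.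

    The heart of the proof is the bound [gmres_bound]
      |r_n| <= |r_0| prod_(j <= n) sigma_j(M - Id) sigma_j(M^-1)
    on the residuals of the preconditioned iteration.  It comes from volumes:
    let gram(x_1, ..., x_n) be the Gram determinant, the square of the volume of
    the parallelepiped.  With r = r_0 and K = M - Id,
      |r_n|^2 gram(M r, ..., M^n r) <= gram(r, M r, ..., M^n r)
        = gram(r, K r, K M r, ..., K M^(n-1) r)
        <= |r|^2 gram(K r, K M r, ..., K M^(n-1) r);
    the first step is the minimality of r_n, the equality is a unipotent change
    of vectors, the last step is Fischer's inequality ([fischer]).  A linear map
    L multiplies squares of n-dimensional volumes by at most
    prod_(j <= n) sigma_j(L)^2 ([gram_contract]); this is used for K and for
    M^-1, and the volume gram(r, M r, ..., M^(n-1) r) cancels.  If it vanishes,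
    the Krylov space already contains the solution and r_n = 0.

    Residuals of the original and of the preconditioned equations differ by the
    factors |G_r| <= 2 + sigma_1 and |G_r^-1|, which gives the constant of the
    theorem ([preconditioned_gmres_bound], a statement on abstract operators).

    It remains to check the assumptions of this abstract statement.  As T_+ is
    the Riesz map of the reference scalar product, T is a compact perturbation
    of it, positive and thus coercive; by the representation theorem T is
    bijective and the norm T^-1 is complete and equivalent to the dual norm
    ([tnorm_coercive], [impedance_bijective], [dnorm_equiv]).  The operator
    (Pi + Id) / 2 is an orthogonal projection, so Pi is an isometry; S is a
    contraction because Im <A u, conj u> <= 0.  Both facts need that the trace
    maps commute with complex conjugation, which is checked on the concrete
    function spaces. *)

(** * Linear maps, scalar products and Gram determinants *)

(** The first half of [bounded_linear], for maps on which no norm is fixed. *)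
Definition lin_map (R : realType) (V W : lmodType R[i]) (f : V -> W) : Prop :=
  forall (a : R[i]) x y, f (a *: x + y) = a *: f x + f y.

Section linear_maps.
Variables (R : realType) (V W U : lmodType R[i]).
Implicit Types (f : V -> W) (g : W -> U).

Lemma lin_map0 f : lin_map f -> f 0 = 0.
Proof.
by move=> fl; have := fl (-1) 0 0; rewrite scaler0 addr0 scaleN1r addNr.
Qed.

Lemma lin_mapD f : lin_map f -> {morph f : x y / x + y}.
Proof. by move=> fl x y; have := fl 1 x y; rewrite !scale1r. Qed.

Lemma lin_mapZ f : lin_map f -> forall a, {morph f : x / a *: x}.
Proof. by move=> fl a x; have := fl a x 0; rewrite (lin_map0 fl) !addr0. Qed.

Lemma lin_mapN f : lin_map f -> {morph f : x / - x}.
Proof. by move=> fl x; rewrite -scaleN1r (lin_mapZ fl) scaleN1r. Qed.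

Lemma lin_mapB f : lin_map f -> {morph f : x y / x - y}.
Proof. by move=> fl x y; rewrite (lin_mapD fl) (lin_mapN fl). Qed.

Lemma lin_map_sum f : lin_map f -> forall (I : finType) (c : I -> R[i]) (x : I -> V),
  f (\sum_k c k *: x k) = \sum_k c k *: f (x k).
Proof.
move=> fl I c x; elim/big_ind2: _ => [|u1 v1 u2 v2 <- <-|k _].
- exact: lin_map0.
- exact: lin_mapD.
- exact: lin_mapZ.
Qed.

Lemma lin_map_comp f g : lin_map f -> lin_map g -> lin_map (g \o f).
Proof. by move=> fl gl a x y /=; rewrite fl gl. Qed.

Lemma lin_map_inj f : lin_map f -> (forall x, f x = 0 -> x = 0) -> injective f.
Proof.
move=> fl f0 x y fxy; apply/eqP; rewrite -subr_eq0; apply/eqP/f0.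
by rewrite (lin_mapB fl) fxy subrr.
Qed.

Lemma op_invK f : bijective f -> cancel (op_inv f) f.
Proof.
move=> [h hK fK] y; rewrite /op_inv.
by case: xgetP => [x _ //|] /(_ (h y)) /=; rewrite fK.
Qed.

Lemma op_invKr f : bijective f -> cancel f (op_inv f).
Proof. by move=> fb x; apply: (bij_inj fb); rewrite op_invK. Qed.

Lemma lin_map_op_inv f : lin_map f -> bijective f -> lin_map (op_inv f).
Proof.
by move=> fl fb a x y; apply: (bij_inj fb); rewrite fl !op_invK.
Qed.

End linear_maps.

Section hermitian_forms.
Variable R : realType.
Notation C := R[i].

(** A predicate on forms rather than a structure on the space: one space carries
    several scalar products here, such as the reference one and the one of T. *)
Record inner_product (V : lmodType C) (b : V -> V -> C) : Prop := InnerProduct {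
  ip_linear : forall a x y z, b (a *: x + y) z = a * b x z + b y z;
  ip_herm : forall x y, b y x = conjc (b x y);
  ip_gt0 : forall x, x != 0 -> 0 < b x x
}.

Definition ip_norm (V : lmodType C) (b : V -> V -> C) (x : V) : R :=
  Num.sqrt (complex.Re (b x x)).

Lemma dot_inner_product (H : innerSpace R) : inner_product (@dot R H).
Proof. by split; [exact: dot_linear|exact: dot_herm|exact: dot_gt0]. Qed.

Variables (V : lmodType C) (b : V -> V -> C) (bP : inner_product b).
Notation nrm := (ip_norm b).
Implicit Types (x y z : V).

Lemma ip_linl z : forall a x y, b (a *: x + y) z = a * b x z + b y z.
Proof. by move=> *; exact: ip_linear. Qed.

Lemma ip0l z : b 0 z = 0.
Proof.
have := ip_linl z (-1) 0 0.
by rewrite scaler0 addr0 mulN1r addNr.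
Qed.

Lemma ipDl z x y : b (x + y) z = b x z + b y z.
Proof. by have := ip_linl z 1 x y; rewrite scale1r mul1r. Qed.

Lemma ipZl z a x : b (a *: x) z = a * b x z.
Proof. by have := ip_linl z a x 0; rewrite addr0 ip0l addr0. Qed.

Lemma ipNl z x : b (- x) z = - b x z.
Proof. by rewrite -scaleN1r ipZl mulN1r. Qed.

Lemma ipBl z x y : b (x - y) z = b x z - b y z.
Proof. by rewrite ipDl ipNl. Qed.

Lemma ip_suml z (I : finType) (c : I -> C) (x : I -> V) :
  b (\sum_k c k *: x k) z = \sum_k c k * b (x k) z.
Proof.
by elim/big_ind2: _ => [|u1 v1 u2 v2 <- <-|k _]; rewrite ?ip0l ?ipDl ?ipZl.
Qed.

Lemma ip0r z : b z 0 = 0.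
Proof. by rewrite (ip_herm bP) ip0l conjc0. Qed.

Lemma ipDr z x y : b z (x + y) = b z x + b z y.
Proof. by rewrite (ip_herm bP) ipDl rmorphD /= -!(ip_herm bP). Qed.

Lemma ipZr z a x : b z (a *: x) = conjc a * b z x.
Proof. by rewrite (ip_herm bP) ipZl rmorphM /= -(ip_herm bP). Qed.

Lemma ipNr z x : b z (- x) = - b z x.
Proof. by rewrite (ip_herm bP) ipNl rmorphN /= -(ip_herm bP). Qed.

Lemma ipBr z x y : b z (x - y) = b z x - b z y.
Proof. by rewrite ipDr ipNr. Qed.

Lemma ip_sumr z (I : finType) (c : I -> C) (x : I -> V) :
  b z (\sum_k c k *: x k) = \sum_k conjc (c k) * b z (x k).
Proof.
by elim/big_ind2: _ => [|u1 v1 u2 v2 <- <-|k _]; rewrite ?ip0r ?ipDr ?ipZr.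
Qed.

Lemma ip_ge0 x : 0 <= b x x.
Proof.
by have [->|x0] := eqVneq x 0; [rewrite ip0l|exact/ltW/(ip_gt0 bP)].
Qed.

Lemma ip_eq0 x : b x x = 0 -> x = 0.
Proof.
by move=> bx0; apply: contraPP bx0 => /eqP /(ip_gt0 bP) /gt_eqF /negbT/eqP.
Qed.

Lemma ip_normE x : (nrm x ^+ 2)%:C%C = b x x.
Proof.
have := ip_ge0 x; rewrite /ip_norm; case: (b x x) => u v /=.
by rewrite lecE /= => /andP[/eqP -> u0]; rewrite sqr_sqrtr.
Qed.

Lemma ip_norm_sqr x : nrm x ^+ 2 = complex.Re (b x x).
Proof. by rewrite -ip_normE. Qed.

Lemma ip_norm_ge0 x : 0 <= nrm x.
Proof. exact: sqrtr_ge0. Qed.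

Lemma ip_norm0 : nrm 0 = 0.
Proof. by rewrite /ip_norm ip0l sqrtr0. Qed.

Lemma ip_norm_eq0 x : nrm x = 0 -> x = 0.
Proof. by move=> x0; apply: ip_eq0; rewrite -ip_normE x0 expr0n. Qed.

Lemma ip_norm_gt0 x : x != 0 -> 0 < nrm x.
Proof.
move=> x0; rewrite lt_neqAle ip_norm_ge0 andbT eq_sym.
by apply: contra_neq x0; exact: ip_norm_eq0.
Qed.

Lemma sqmodE (z : C) : z * conjc z = (cabs z ^+ 2)%:C%C.
Proof. by rewrite rmorphXn /= cabsE -normCK. Qed.

Lemma ip_normZ a x : nrm (a *: x) = cabs a * nrm x.
Proof.
apply: (@pexpIrn R 2) => //.
- exact: ip_norm_ge0.
- by rewrite nnegrE mulr_ge0 ?cabs_ge0 ?ip_norm_ge0.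
apply: (@complexI R); rewrite ip_normE ipZl ipZr mulrA sqmodE -ip_normE.
by rewrite -rmorphM /= exprMn.
Qed.

Lemma ip_normN x : nrm (- x) = nrm x.
Proof. by rewrite /ip_norm ipNl ipNr opprK. Qed.

Lemma ip_normBC x y : nrm (x - y) = nrm (y - x).
Proof. by rewrite -ip_normN opprB. Qed.

Lemma ip_proj x y : y != 0 -> b (x - (b x y / b y y) *: y) y = 0.
Proof.
move=> y0; rewrite ipBl ipZl divfK ?subrr//.
by apply/negP => /eqP/ip_eq0/eqP; rewrite (negbTE y0).
Qed.

Lemma pythagoras x y : b x y = 0 -> b (x + y) (x + y) = b x x + b y y.
Proof.
move=> xy; have yx : b y x = 0 by rewrite (ip_herm bP) xy conjc0.
by rewrite ipDl !ipDr xy yx add0r addr0.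
Qed.

Lemma cabs_real (r : R) : 0 <= r -> cabs r%:C%C = r.
Proof. by move=> r0; rewrite /cabs ger0_norm ?lecR. Qed.

Lemma cauchy_schwarz x y : cabs (b x y) <= nrm x * nrm y.
Proof.
have [->|y0] := eqVneq y 0; first by rewrite ip0r cabs0 ip_norm0 mulr0.
set t := b x y / b y y.
have yy0 : b y y != 0 by rewrite gt_eqF// (ip_gt0 bP).
have bty : b (x - t *: y) (t *: y) = 0 by rewrite ipZr ip_proj// mulr0.
have := pythagoras bty; rewrite subrK => xx.
have : b (t *: y) (t *: y) <= b x x by rewrite xx lerDr ip_ge0.
rewrite ipZl ipZr mulrA sqmodE -!ip_normE -rmorphM /= lecR -exprMn.
rewrite ler_pXn2r ?nnegrE ?mulr_ge0 ?cabs_ge0 ?ip_norm_ge0//.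
move=> h; have -> : b x y = t * b y y by rewrite divfK.
rewrite cabsM -ip_normE cabs_real ?sqr_ge0//.
by rewrite expr2 mulrA ler_wpM2r ?ip_norm_ge0.
Qed.

Lemma Re_le_cabs (z : C) : complex.Re z <= cabs z.
Proof.
case: z => u v; rewrite /cabs normc_def /=.
rewrite (le_trans (ler_norm _))// -sqrtr_sqr ler_sqrt ?lerDl ?sqr_ge0//.
by rewrite addr_ge0 ?sqr_ge0.
Qed.

Lemma ip_norm_sqrD x y :
  nrm (x + y) ^+ 2 = nrm x ^+ 2 + nrm y ^+ 2 + 2 * complex.Re (b x y).
Proof.
rewrite !ip_norm_sqr ipDl !ipDr (ip_herm bP x y).
case: (b x x) (b x y) (b y y) => [? ?] [? ?] [? ?] /=; ring.
Qed.

Lemma ip_normD x y : nrm (x + y) <= nrm x + nrm y.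
Proof.
rewrite -(@ler_pXn2r R 2) ?nnegrE ?addr_ge0 ?ip_norm_ge0//.
rewrite ip_norm_sqrD.
have := le_trans (Re_le_cabs (b x y)) (cauchy_schwarz x y).
by move: (complex.Re _) (nrm x) (nrm y) => r u v ruv; nra.
Qed.

Lemma ip_normB x y : nrm (x - y) <= nrm x + nrm y.
Proof. by rewrite -(ip_normN y); exact: ip_normD. Qed.

End hermitian_forms.

Section gram.
Variable R : realType.
Notation C := R[i].
Variables (V : lmodType C) (b : V -> V -> C) (bP : inner_product b).
Notation nrm := (ip_norm b).

(** The square of the n-dimensional volume spanned by the family. *)
Definition gram n (x : 'I_n -> V) : C := \det (\matrix_(i, j) b (x i) (x j)).

(** The families obtained from x by the rows of A; with one row, a single linear
    combination. *)
Definition comb m n (A : 'M[C]_(m, n)) (x : 'I_n -> V) (i : 'I_m) : V :=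
  \sum_k A i k *: x k.

Lemma eq_gram n (x y : 'I_n -> V) : x =1 y -> gram x = gram y.
Proof. by move=> xy; congr (\det _); apply/matrixP => i j; rewrite !mxE !xy. Qed.

(** The Gram matrix becomes A G A^*, whence the factor |det A|^2. *)
Lemma gram_comb n (A : 'M[C]_n) (x : 'I_n -> V) :
  gram (comb A x) = `|\det A| ^+ 2 * gram x.
Proof.
rewrite /gram.
have -> : \matrix_(i, j) b (comb A x i) (comb A x j) =
    A *m (\matrix_(i, j) b (x i) (x j)) *m (map_mx (@conjc R) A)^T.
  apply/matrixP => i j; rewrite !mxE (ip_suml bP).
  under [RHS]eq_bigr => k _ do rewrite !mxE big_distrl /=.
  rewrite [RHS]exchange_big /=; apply: eq_bigr => l _.
  rewrite (ip_sumr bP) big_distrr /=; apply: eq_bigr => k _.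
  by rewrite !mxE mulrA mulrAC.
by rewrite !det_mulmx det_tr det_map_mx normCK mulrAC.
Qed.

Lemma gram_unimodular n (A : 'M[C]_n) (x : 'I_n -> V) :
  \det A = 1 -> gram (comb A x) = gram x.
Proof. by move=> A1; rewrite gram_comb A1 normr1 expr1n mul1r. Qed.

(** Volume is height times base: the first row of the Gram matrix has a single
    nonzero entry. *)
Lemma gram_orth n (z : 'I_n.+1 -> V) :
  (forall i, b (z ord0) (z (lift ord0 i)) = 0) ->
  gram z = b (z ord0) (z ord0) * gram (z \o lift ord0).
Proof.
move=> z0; rewrite /gram (expand_det_row _ ord0) big_ord_recl big1 ?addr0.
  rewrite mxE; congr (_ * _).
  rewrite /cofactor /= expr0 mul1r; congr (\det _).
  by apply/matrixP => i j; rewrite !mxE.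
by move=> i _; rewrite mxE z0 mul0r.
Qed.

(** A row vector c in the kernel of the Gram matrix gives a combination of the
    family that is orthogonal to the family, hence to itself. *)
Lemma gram_dep n (x : 'I_n -> V) :
  gram x = 0 <-> exists2 c : 'rV[C]_n, c != 0 & comb c x ord0 = 0.
Proof.
split=> [/eqP/det0P[c c0 cG]|[c c0 cx]]; last first.
  apply/eqP/det0P; exists c => //; apply/matrixP => i j.
  rewrite !mxE -[RHS](ip0l bP (x j)) -cx (ip_suml bP).
  by apply: eq_bigr => k _; rewrite mxE ord1.
exists c => //; apply: (ip_eq0 bP).
rewrite {2}/comb (ip_sumr bP) big1// => j _.
rewrite (ip_suml bP); move/matrixP/(_ ord0 j): cG; rewrite !mxE => cG.
suff -> : \sum_k c ord0 k * b (x k) (x j) = 0 by rewrite mulr0.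
by rewrite -[RHS]cG; apply: eq_bigr => k _; rewrite mxE.
Qed.

Lemma gram_lift_dep n (z : 'I_n.+1 -> V) : gram (z \o lift ord0) = 0 -> gram z = 0.
Proof.
move=> /gram_dep[c c0 cz]; apply/gram_dep.
exists (row_mx (0 : 'rV_1) c : 'rV_(1 + n)).
  by apply: contra_neq c0 => h; rewrite -(row_mxKr (0 : 'rV[C]_1) c) h linear0.
rewrite /comb big_ord_recl /=.
have -> : (row_mx (0 : 'rV_1) c : 'rV_(1 + n)) ord0 ord0 = 0.
  have -> : (ord0 : 'I_(1 + n)) = lshift n ord0 by exact: val_inj.
  by rewrite row_mxEl mxE.
rewrite scale0r add0r -[RHS]cz; apply: eq_bigr => k _; congr (_ *: _).
have ol : (lift ord0 k : 'I_(1 + n)) = rshift 1 k by exact: val_inj.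
by rewrite [X in fun_of_matrix _ _ X]ol; exact: row_mxEr.
Qed.

(** Orthogonal projection on the span of a free family, the coefficients being
    obtained by inverting the Gram matrix. *)
Lemma gram_proj n (x : 'I_n -> V) (y : V) : gram x != 0 ->
  exists c : 'rV[C]_n, forall i, b (y - comb c x ord0) (x i) = 0.
Proof.
move=> Gx; pose G := \matrix_(i, j) b (x i) (x j).
have Gu : G \in unitmx by rewrite unitmxE unitfE.
pose v := \row_j b y (x j); exists (v *m invmx G) => i.
have := mulmxKV Gu v => /matrixP/(_ ord0 i); rewrite !mxE => h.
rewrite (ipBl bP) -h (ip_suml bP); apply/eqP; rewrite subr_eq0; apply/eqP.
by apply: eq_bigr => k _; rewrite !mxE.
Qed.

(** Moving the first vector along the span of the others preserves the volume. *)
Lemma gram_shear n (z : 'I_n.+1 -> V) (c : 'rV[C]_n) :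
  gram (fun i => if unlift ord0 i is Some j then z i
                 else z ord0 - comb c (z \o lift ord0) ord0) = gram z.
Proof.
pose A : 'M[C]_(1 + n) := block_mx 1%:M (- c) 0 1%:M.
rewrite -[RHS](@gram_unimodular _ A); last by rewrite det_ublock !det1 mul1r.
apply: eq_gram => i; rewrite /comb big_ord_recl /=.
have o0 : (ord0 : 'I_(1 + n)) = lshift n ord0 by exact: val_inj.
have ol k : (lift ord0 k : 'I_(1 + n)) = rshift 1 k by exact: val_inj.
case: unliftP => [j|] ->.
  rewrite (bigD1 j)//= {1 2}ol {1}o0 block_mxEdl mxE scale0r add0r ol.
  rewrite block_mxEdr mxE eqxx scale1r big1 ?addr0// => k kj.
  by rewrite ol block_mxEdr mxE eq_sym (negbTE kj) scale0r.
have -> : A ord0 ord0 = 1 by rewrite o0 block_mxEul mxE eqxx.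
rewrite scale1r; congr (_ + _); rewrite -sumrN; apply: eq_bigr => k _.
have -> : A ord0 (lift ord0 k) = - c ord0 k by rewrite ol o0 block_mxEur mxE.
by rewrite scaleNr.
Qed.

(** Replacing the first vector by its component orthogonal to the others computes
    the volume as height times base; the height is at most the length. *)
Lemma gram_step n (z : 'I_n.+1 -> V) : gram (z \o lift ord0) != 0 ->
  exists2 c : 'rV[C]_n,
    let y := z ord0 - comb c (z \o lift ord0) ord0 in
    gram z = b y y * gram (z \o lift ord0) &
    let y := z ord0 - comb c (z \o lift ord0) ord0 in
    b y y <= b (z ord0) (z ord0).
Proof.
move=> Gz; have [c cP] := gram_proj (z ord0) Gz.
exists c => /=.
  rewrite -(gram_shear z c) gram_orth /=; last first.
    by move=> i; rewrite unlift_none liftK; exact: cP.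
  rewrite unlift_none; congr (_ * _); apply: eq_gram => i /=.
  by rewrite liftK.
set p := comb _ _ _; set y := z ord0 - p.
have yp : b y p = 0.
  by rewrite /p /comb (ip_sumr bP) big1// => k _; rewrite [b y _]cP mulr0.
have -> : z ord0 = y + p by rewrite subrK.
by rewrite (pythagoras bP yp) lerDl (ip_ge0 bP).
Qed.

Lemma gram_ge0 n (z : 'I_n -> V) : 0 <= gram z.
Proof.
elim: n z => [z|n IH z]; first by rewrite /gram det_mx00.
have [G0|Gz] := eqVneq (gram (z \o lift ord0)) 0.
  by rewrite (gram_lift_dep G0).
by have [c /= -> _] := gram_step Gz; rewrite mulr_ge0 ?(ip_ge0 bP).
Qed.

(** Fischer's inequality: the height does not exceed the length of the edge. *)
Lemma fischer n (z : 'I_n.+1 -> V) :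
  gram z <= b (z ord0) (z ord0) * gram (z \o lift ord0).
Proof.
have [G0|Gz] := eqVneq (gram (z \o lift ord0)) 0.
  by rewrite (gram_lift_dep G0) G0 mulr0.
by have [c /= -> h] := gram_step Gz; rewrite ler_wpM2r ?gram_ge0.
Qed.

End gram.

(** * Volumes and approximation numbers *)

(** Removes the slack e from estimates with approximation numbers, which are
    infima that need not be attained. *)
Lemma le_sqr_addgt0 (R : realType) (a s q : R) : 0 <= s -> 0 <= q ->
  (forall e, 0 < e -> a <= (s + e) ^+ 2 * q) -> a <= s ^+ 2 * q.
Proof.
move=> s0 q0 h; apply/ler_addgt0Pr => e e0.
pose k := (2 * s + 1) * q + 1.
have k0 : 0 < k by rewrite ltr_pwDr// mulr_ge0// addr_ge0// mulr_ge0.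
pose d := Num.min 1 (e / k).
have d0 : 0 < d by rewrite lt_min ltr01 divr_gt0.
have d1 : d <= 1 by rewrite ge_min lexx.
have dk : d * k <= e by rewrite -ler_pdivlMr// ge_min lexx orbT.
have ddq : d * d * q <= d * q by rewrite ler_wpM2r// ler_piMr// ltW.
apply: (le_trans (h _ d0)).
apply: (@le_trans _ _ (s ^+ 2 * q + d * k)); last by rewrite lerD2l.
by rewrite /k; lra.
Qed.

Section approximation.
Variable R : realType.
Notation C := R[i].
Variables (V : lmodType C) (b : V -> V -> C) (bP : inner_product b).
Notation nrm := (ip_norm b).

(** An upper bound s of the j-th approximation number of L. The approximants are
    linear maps of rank less than j, the slack e standing for the infimum. *)
Definition approx_le (L : V -> V) (j : nat) (s : R) : Prop :=
  forall e, 0 < e -> exists L' : V -> V, [/\ lin_map L', rank_lt j L' &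
    forall x, nrm (L x - L' x) <= (s + e) * nrm x].

(** Moving the other vectors along the first one preserves the volume. *)
Lemma gram_shear_col n (z : 'I_n.+1 -> V) (t : 'I_n -> C) :
  gram b (fun i => if unlift ord0 i is Some j then z i - t j *: z ord0
                   else z i) = gram b z.
Proof.
pose A : 'M[C]_(1 + n) := block_mx 1%:M 0 (\col_i - t i) 1%:M.
rewrite -[RHS](@gram_unimodular _ _ _ bP _ A); last by rewrite det_lblock !det1 mul1r.
apply: eq_gram => i; rewrite /comb big_ord_recl /=.
have o0 : (ord0 : 'I_(1 + n)) = lshift n ord0 by exact: val_inj.
have ol k : (lift ord0 k : 'I_(1 + n)) = rshift 1 k by exact: val_inj.
case: unliftP => [j|] ->.
  have -> : A (lift ord0 j) ord0 = - t j by rewrite ol o0 block_mxEdl mxE.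
  have Ad k : A (lift ord0 j) (lift ord0 k) = (j == k)%:R.
    by rewrite !ol block_mxEdr mxE.
  rewrite (bigD1 j)//= Ad eqxx scale1r big1 ?addr0; first by rewrite addrC scaleNr.
  by move=> k kj; rewrite Ad eq_sym (negbTE kj) scale0r.
have -> : A ord0 ord0 = 1 by rewrite o0 block_mxEul mxE eqxx.
rewrite scale1r big1 ?addr0// => k _.
have -> : A ord0 (lift ord0 k) = 0 by rewrite ol o0 block_mxEur mxE.
by rewrite scale0r.
Qed.

(** Orthogonalize the other vectors to the first one, which changes neither volume
    since L is linear. The height then grows at most by t, and the base by the
    assumption on families of n vectors. *)
Lemma gram_contract_step n (L : V -> V) (t q : R) (z : 'I_n.+1 -> V) :
  lin_map L -> 0 <= t -> 0 <= q ->
  nrm (L (z ord0)) <= t * nrm (z ord0) ->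
  (forall w : 'I_n -> V, gram b (L \o w) <= q%:C%C * gram b w) ->
  gram b (L \o z) <= (t ^+ 2 * q)%:C%C * gram b z.
Proof.
move=> Ll t0 q0 Lz0 IH.
have [z00|z00] := eqVneq (z ord0) 0.
  apply: (le_trans (fischer bP (L \o z))).
  rewrite /= z00 (lin_map0 Ll) (ip0l bP) mul0r mulr_ge0 ?(gram_ge0 bP)//.
  by rewrite lecR mulr_ge0// exprn_ge0.
pose c j := b (z (lift ord0 j)) (z ord0) / b (z ord0) (z ord0).
pose w (i : 'I_n.+1) := if unlift ord0 i is Some j then z i - c j *: z ord0 else z i.
have -> : gram b (L \o z) = gram b (L \o w).
  rewrite -(gram_shear_col (L \o z) c); apply: eq_gram => i /=; rewrite /w.
  by case: unlift => [j|]//; rewrite (lin_mapB Ll) (lin_mapZ Ll).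
have -> : gram b z = gram b w by rewrite -(gram_shear_col z c).
have w0 : w ord0 = z ord0 by rewrite /w unlift_none.
rewrite (@gram_orth _ _ b _ w); last first.
  move=> i; rewrite w0 /w liftK (ip_herm bP).
  by rewrite (ip_proj bP)// conjc0.
apply: (le_trans (fischer bP (L \o w))).
apply: (@le_trans _ _ (b (L (w ord0)) (L (w ord0)) *
    (q%:C%C * gram b (w \o lift ord0)))).
  by rewrite ler_wpM2l ?(ip_ge0 bP)//; exact: IH.
rewrite w0 -!(ip_normE bP) !mulrA -!rmorphM /= ler_wpM2r ?(gram_ge0 bP)//.
rewrite lecR [X in _ <= X]mulrAC -exprMn ler_wpM2r//.
by rewrite ler_pXn2r ?nnegrE ?mulr_ge0 ?ip_norm_ge0.
Qed.

Lemma exists_row_unitmx n (c : 'rV[C]_n.+1) : c != 0 ->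
  exists2 A : 'M[C]_n.+1, A \in unitmx & row ord0 A = c.
Proof.
move=> c0; pose f := \matrix_(i < n.+1, j < n.+1) c ord0 j.
pose U : 'rV[C]_n.+1 := delta_mx ord0 ord0.
have Uf : U *m f = c.
  by rewrite /U -rowE; apply/rowP => j; rewrite !mxE.
have [|g gu gE] := @complete_unitmx _ _ _ U f.
  rewrite Uf !rank_rV c0; have -> // : U != 0.
  apply/negP => /eqP/matrixP/(_ ord0 ord0); rewrite !mxE !eqxx => /eqP.
  by rewrite oner_eq0.
by exists g => //; rewrite rowE -gE Uf.
Qed.

Lemma exists_kernel_row m n (D : 'M[C]_(n.+1, m)) : (m <= n)%N ->
  exists2 c : 'rV[C]_n.+1, c != 0 & c *m D = 0.
Proof.
move=> mn; have : kermx D != 0.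
  rewrite kermx_eq0 /row_free neq_ltn (leq_ltn_trans (rank_leq_col D))//.
by move=> /rowV0Pn[c /sub_kermxP cD c0]; exists c.
Qed.

(** A linear map multiplies n-dimensional volumes by at most the product of its
    first n approximation numbers. By induction on n: a map L' of rank less than
    n.+1 kills a nonzero combination y of the n.+1 vectors, on which |L y| is thus
    at most |L - L'| |y|; complete y to a new family of vectors with the same span
    and apply [gram_contract_step]. *)
Lemma gram_contract n (L : V -> V) (s : nat -> R) (x : 'I_n -> V) :
  lin_map L ->
  (forall j, (0 < j <= n)%N -> 0 <= s j /\ approx_le L j (s j)) ->
  gram b (L \o x) <= (\prod_(1 <= j < n.+1) s j ^+ 2)%:C%C * gram b x.
Proof.
move=> Ll; elim: n x => [|n IH] x sP.
  by rewrite big_geq// mul1r /gram !det_mx00.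
have {}IH (w : 'I_n -> V) : gram b (L \o w) <= (\prod_(1 <= j < n.+1) s j ^+ 2)%:C%C * gram b w.
  by apply: IH => j /andP[j0 jn]; apply: sP; rewrite j0 leqW.
have [sn sA] := sP n.+1 (leqnn _).
rewrite big_nat_recr//=; set q := \prod_(_ <= _ < _) _ in IH *.
have q0 : 0 <= q by apply: prodr_ge0 => j _; exact: sqr_ge0.
have Gr m (w : 'I_m -> V) : gram b w = (complex.Re (gram b w))%:C%C.
  have := gram_ge0 bP w; case: (gram b w) => u v.
  by rewrite lecE /= => /andP[/eqP ->].
rewrite [gram b (L \o x)]Gr [gram b x]Gr -rmorphM lecR (mulrC q) -mulrA.
apply: le_sqr_addgt0 => //.
  by rewrite mulr_ge0// -lecR -Gr gram_ge0.
move=> e e0; rewrite mulrA -lecR rmorphM /= -!Gr.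
have [L' [L'l [m [v [mn L'v]]] L'P]] := sA e e0.
have [D DP] := choice (fun i => L'v (x i)).
have [c c0 cD] := exists_kernel_row (\matrix_(i, k) D i k) mn.
have [A Au Ac] := exists_row_unitmx c0.
have A0 : 0 < `|\det A| ^+ 2.
  by rewrite exprn_gt0// normr_gt0 -unitfE -unitmxE.
rewrite -(ler_pM2l A0) mulrCA -!(gram_comb bP).
have -> : gram b (comb A (L \o x)) = gram b (L \o comb A x).
  by apply: eq_gram => i /=; rewrite (lin_map_sum Ll).
have zE : comb A x ord0 = \sum_i c ord0 i *: x i.
  by apply: eq_bigr => i _; rewrite -Ac mxE.
apply: gram_contract_step => //; first by rewrite addr_ge0// ltW.
have L'0 : L' (comb A x ord0) = 0.
  rewrite zE (lin_map_sum L'l).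
  under eq_bigr => i _ do rewrite DP scaler_sumr.
  rewrite exchange_big big1//= => k _.
  under eq_bigr => i _ do rewrite scalerA.
  rewrite -scaler_suml; move/matrixP/(_ ord0 k): cD; rewrite !mxE => cD.
  by under eq_bigr => i _ do rewrite -[D i k](mxE matrix_key); rewrite cD scale0r.
by have := L'P (comb A x ord0); rewrite L'0 subr0.
Qed.

End approximation.

(** * Residuals of GMRes *)

Section gmres.
Variable R : realType.
Notation C := R[i].
Variables (V : lmodType C) (b : V -> V -> C) (bP : inner_product b).
Notation nrm := (ip_norm b).

(** If r, M r, ..., M^(n-1) r are dependent, then r lies in the span of
    M r, ..., M^n r: isolate the term of lowest degree in the relation, after
    cancelling a power of the injective map M. *)
Lemma krylov_dependent (M : V -> V) (r : V) : lin_map M -> injective M ->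
  forall n (c : 'rV[C]_n), c != 0 -> \sum_k c ord0 k *: iter k M r = 0 ->
  exists d : 'I_n -> C, r = \sum_k d k *: iter k.+1 M r.
Proof.
move=> Ml Mi; elim=> [c|n IH c c0]; first by rewrite thinmx0 eqxx.
rewrite big_ord_recl /=; set e := c ord0 ord0.
have [e0|e0] := eqVneq e 0.
  rewrite e0 scale0r add0r => cM.
  pose c' := \row_k c ord0 (lift ord0 k).
  have [||d rd] := IH c'.
  - apply: contra_neq c0 => c'0; apply/rowP => k; rewrite mxE.
    case: (unliftP ord0 k) => [j|] ->; last exact: e0.
    by move/rowP/(_ j): c'0; rewrite !mxE.
  - apply: Mi; rewrite (lin_map0 Ml) (lin_map_sum Ml) -[RHS]cM.
    by apply: eq_bigr => k _; rewrite mxE.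
  exists (fun k => if unlift ord_max k is Some j then d j else 0).
  rewrite big_ord_recr /= unlift_none scale0r addr0 {1}rd.
  apply: eq_bigr => k _.
  have -> : widen_ord (leqnSn n) k = lift ord_max k.
    by apply: val_inj; rewrite /= /bump leqNgt ltn_ord.
  by rewrite liftK.
move=> cM; pose c' k : C := - e^-1 * c ord0 (lift ord0 k).
exists (fun k => if unlift ord_max k is Some j then c' j else 0).
rewrite big_ord_recr /= unlift_none scale0r addr0.
apply: (scalerI e0); apply/eqP; rewrite -subr_eq0; apply/eqP.
rewrite -[RHS]cM; congr (_ + _); rewrite scaler_sumr -sumrN.
apply: eq_bigr => k _; rewrite /=.
have -> : widen_ord (leqnSn n) k = lift ord_max k.
  by apply: val_inj; rewrite /= /bump leqNgt ltn_ord.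
by rewrite liftK /c' scalerA mulrA mulrN divff// mulN1r scaleNr opprK.
Qed.

(** Subtracting from each M^(k+1) r its predecessor M^k r is a unipotent change of
    vectors. *)
Lemma gram_krylov (M : V -> V) (r : V) n :
  gram b (fun i : 'I_n.+1 => if unlift ord0 i is Some j
            then M (iter j M r) - iter j M r else r)
  = gram b (fun i : 'I_n.+1 => iter i M r).
Proof.
pose A : 'M[C]_n.+1 := \matrix_(i, k) ((i == k)%:R - (i == k.+1 :> nat)%:R).
rewrite -[RHS](@gram_unimodular _ _ _ bP _ A); last first.
  rewrite det_trig.
    by rewrite big1 // => i _; rewrite mxE eqxx (ltn_eqF (ltnSn i)) subr0.
  apply/is_trig_mxP => i k ik; rewrite mxE -val_eqE /= ltn_eqF//.
  by rewrite ltn_eqF ?subr0// ltnS ltnW.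
apply: eq_gram => i; rewrite /comb.
under [RHS]eq_bigr => k _ do rewrite mxE scalerBl.
rewrite sumrB (bigD1 i)//= eqxx scale1r big1 ?addr0; last first.
  by move=> k ki; rewrite eq_sym (negbTE ki) scale0r.
case: unliftP => [j|] ->; last first.
  by rewrite big1 ?subr0// => k _; rewrite scale0r.
congr (_ - _); rewrite big_ord_recr /=.
rewrite {1}/bump leq0n add1n eqSS ltn_eqF ?ltn_ord// scale0r addr0.
rewrite (bigD1 j)//= eqxx scale1r big1 ?addr0// => k kj.
by rewrite eqSS val_eqE eq_sym (negbTE kj) scale0r.
Qed.

(** Minimality bounds |r_n|^2 times the square volume of M r, ..., M^n r by that of
    r, M r, ..., M^n r. Both are compared with the square volume of
    r, ..., M^(n-1) r by [gram_contract], applied to Minv for the first and to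
    M - Id, after [gram_krylov] and [fischer], for the second. *)
Lemma gmres_bound (M Minv : V -> V) (s t : nat -> R) (g p0 p : V) n :
  lin_map M -> lin_map Minv -> cancel M Minv ->
  (forall j, (0 < j <= n)%N -> 0 <= s j /\ approx_le b (fun x => M x - x) j (s j)) ->
  (forall j, (0 < j <= n)%N -> 0 <= t j /\ approx_le b Minv j (t j)) ->
  is_gmres_iterate nrm M g p0 n p ->
  nrm (g - M p) <= nrm (g - M p0) * \prod_(1 <= j < n.+1) (s j * t j).
Proof.
move=> Ml Minvl MK sP tP [[c pE] pmin].
set r := g - M p0 in pE pmin *; set rho := g - M p in pmin *.
pose x (i : 'I_n) := iter i M r; pose y (i : 'I_n) := iter i.+1 M r.
pose z (i : 'I_n.+1) := iter i M r.
have rho_min (d : 'I_n -> C) : nrm rho <= nrm (r - \sum_k d k *: y k).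
  pose q := p0 + \sum_k d k *: x k.
  have -> : r - \sum_k d k *: y k = g - M q.
    by rewrite /q (lin_mapD Ml) (lin_map_sum Ml) opprD addrA.
  by apply: pmin; exists d; rewrite /q addrC addKr.
have prod_ge0 (u : nat -> R) : (forall j, (0 < j <= n)%N -> 0 <= u j) ->
    0 <= \prod_(1 <= j < n.+1) u j.
  by move=> u0; rewrite big_nat; apply: prodr_ge0 => j; exact: u0.
have ps0 := prod_ge0 _ (fun j jn => proj1 (sP j jn)).
have pt0 := prod_ge0 _ (fun j jn => proj1 (tP j jn)).
have [x0|x0] := eqVneq (gram b x) 0.
  have [d d0 xd] := (gram_dep bP x).1 x0.
  have [e re] := krylov_dependent Ml (can_inj MK) d0 xd.
  apply: (@le_trans _ _ 0).
    by rewrite (le_trans (rho_min e))// -re subrr (ip_norm0 bP).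
  by rewrite big_split /= !mulr_ge0 ?ip_norm_ge0.
have xgt0 : 0 < gram b x by rewrite lt_neqAle eq_sym x0 (gram_ge0 bP).
have xy : gram b x <= (\prod_(1 <= j < n.+1) t j ^+ 2)%:C%C * gram b y.
  rewrite (_ : gram b x = gram b (Minv \o y)).
    exact: (gram_contract bP).
  by apply: eq_gram => i /=; rewrite MK.
have y0 : gram b y != 0.
  apply: contraTneq xy => ->; rewrite mulr0; apply/negP => /(lt_le_trans xgt0).
  by rewrite ltxx.
have zy : b rho rho * gram b y <= gram b z.
  have zl : gram b (z \o lift ord0) = gram b y by exact: eq_gram.
  have zl0 : gram b (z \o lift ord0) != 0 by rewrite zl.
  have [d /= -> _] := gram_step bP zl0.
  rewrite zl ler_wpM2r ?(gram_ge0 bP)// -!(ip_normE bP) lecR.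
  rewrite ler_pXn2r ?nnegrE ?ip_norm_ge0//.
  exact: rho_min.
have zx : gram b z <= b r r * ((\prod_(1 <= j < n.+1) s j ^+ 2)%:C%C * gram b x).
  rewrite /z -gram_krylov; apply: (le_trans (fischer bP _)).
  rewrite unlift_none ler_wpM2l ?(ip_ge0 bP)//.
  rewrite [X in X <= _](_ : _ = gram b ((fun v => M v - v) \o x)).
    apply: (gram_contract bP) => // a u v.
    by rewrite Ml scalerBr opprD addrACA.
  by apply: eq_gram => i /=; rewrite liftK.
have : b rho rho * gram b x <= ((nrm r * \prod_(1 <= j < n.+1) (s j * t j)) ^+ 2)%:C%C * gram b x.
  apply: (le_trans (ler_wpM2l (ip_ge0 bP rho) xy)).
  rewrite mulrCA.
  have tt0 : 0 <= (\prod_(1 <= j < n.+1) t j ^+ 2)%:C%C :> C.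
    by rewrite lecR; apply: prodr_ge0 => j _; exact: sqr_ge0.
  apply: (le_trans (ler_wpM2l tt0 (le_trans zy zx))).
  have -> : (nrm r * \prod_(1 <= j < n.+1) (s j * t j)) ^+ 2 =
      nrm r ^+ 2 * (\prod_(1 <= j < n.+1) s j ^+ 2 * \prod_(1 <= j < n.+1) t j ^+ 2).
    by rewrite exprMn big_split /= exprMn -!prodrXl.
  rewrite rmorphM /= (ip_normE bP) rmorphM /=.
  set u := (\prod_(1 <= j < n.+1) s j ^+ 2)%:C%C.
  set v := (\prod_(1 <= j < n.+1) t j ^+ 2)%:C%C.
  by rewrite [X in X <= _](_ : _ = b r r * (u * v) * gram b x)//; ring.
rewrite ler_pM2r// -(ip_normE bP) lecR ler_pXn2r ?nnegrE ?ip_norm_ge0//.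
by rewrite big_split !mulr_ge0 ?ip_norm_ge0.
Qed.

End gmres.

(** * Consequences of completeness *)

Section completeness.
Variable R : realType.
Notation C := R[i].

Definition norm_complete (V : lmodType C) (nrm : V -> R) : Prop :=
  forall u : nat -> V,
    (forall e : R, 0 < e -> exists N : nat, forall m n : nat,
       (N <= m)%N -> (N <= n)%N -> nrm (u m - u n) < e) ->
  exists l : V, (fun n => nrm (u n - l)) @ \oo --> (0 : R).

Lemma cvg0P (f : nat -> R) : f @ \oo --> 0 <->
  forall e, 0 < e -> exists N : nat, forall n, (N <= n)%N -> `|f n| < e.
Proof.
split=> [/cvgrPdist_lt h e e0|h].
  have [N _ NP] := h e e0; exists N => n Nn.
  by have := NP n Nn; rewrite /= sub0r normrN.
apply/cvgrPdist_lt => e e0; have [N NP] := h e e0.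
by exists N => // n /= Nn; rewrite sub0r normrN NP.
Qed.

Lemma cabsN (z : C) : cabs (- z) = cabs z.
Proof. by rewrite /cabs normrN. Qed.

Lemma cabs_conj (z : C) : cabs (conjc z) = cabs z.
Proof. by apply: (@complexI R); rewrite !cabsE norm_conjC. Qed.

Lemma real_complexV (r : R) : (r^-1)%:C%C = (r%:C%C)^-1.
Proof. exact: (fmorphV (real_complex R)). Qed.

Lemma cabs_eq0 (z : C) : cabs z = 0 -> z = 0.
Proof. by move=> z0; apply/eqP; rewrite -normr_eq0 -cabsE z0. Qed.

Section opnorm.
Variables (V W : lmodType C) (nV : V -> R) (nW : W -> R).
Hypotheses (nV0 : forall x, 0 <= nV x).

Lemma opnorm_ge0 (f : V -> W) : 0 <= opnorm nV nW f.
Proof.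
rewrite /opnorm; set S := [set _ | _].
have [->|/set0P S0] := eqVneq S set0; first by rewrite inf0.
by apply: lb_le_inf => // M [].
Qed.

Lemma le_opnorm (f : V -> W) : (exists M, forall x, nW (f x) <= M * nV x) ->
  forall x, nW (f x) <= opnorm nV nW f * nV x.
Proof.
move=> [M fM] x; have fM' y : nW (f y) <= `|M| * nV y.
  by rewrite (le_trans (fM y))// ler_wpM2r// ler_norm.
have [x0|x0] := eqVneq (nV x) 0; first by have := fM x; rewrite x0 !mulr0.
have xgt0 : 0 < nV x by rewrite lt_neqAle eq_sym x0 nV0.
rewrite -ler_pdivrMr//; apply: lb_le_inf; first by exists `|M|; split.
by move=> N [N0 fN]; rewrite ler_pdivrMr.
Qed.

Lemma opnorm_le (f : V -> W) M : 0 <= M -> (forall x, nW (f x) <= M * nV x) ->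
  opnorm nV nW f <= M.
Proof. by move=> M0 fM; apply: ge_inf => //; exists 0 => N []. Qed.

End opnorm.

Variables (V : lmodType C) (b : V -> V -> C) (bP : inner_product b).
Hypothesis bC : norm_complete (ip_norm b).
Notation nrm := (ip_norm b).

(** The iteration u_(n+1) = y + E u_n, started at 0, satisfies
    |u_(n+k) - u_n| <= q^n |u_k| with |u_k| bounded by |y| / (1 - q). *)
Lemma neumann_surjective (E : V -> V) (q : R) : lin_map E -> 0 <= q < 1 ->
  (forall x, nrm (E x) <= q * nrm x) -> forall y, exists x, x - E x = y.
Proof.
move=> El /andP[q0 q1] Eq y.
pose u := fix u n := if n is n'.+1 then y + E (u n') else 0.
have q10 : 0 < 1 - q by rewrite subr_gt0.
pose K := nrm y / (1 - q).
have K0 : 0 <= K by rewrite divr_ge0 ?ip_norm_ge0// ltW.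
have uK k : nrm (u k) <= K.
  elim: k => [|k IH] /=; first by rewrite (ip_norm0 bP).
  apply: (le_trans (ip_normD bP _ _)).
  apply: (@le_trans _ _ (nrm y + q * K)).
    by rewrite lerD2l (le_trans (Eq _))// ler_wpM2l.
  suff -> : nrm y = (1 - q) * K by rewrite -mulrDl subrK mul1r.
  by rewrite mulrC divfK// gt_eqF.
have udist n k : nrm (u (n + k)%N - u n) <= q ^+ n * K.
  elim: n => [|n IH]; first by rewrite add0n subr0 expr0 mul1r.
  rewrite addSn /= opprD addrACA subrr add0r -(lin_mapB El).
  by rewrite (le_trans (Eq _))// exprS -mulrA ler_wpM2l.
have qK0 : (fun n => q ^+ n * K) @ \oo --> 0.
  rewrite -[X in _ --> X](mul0r K); apply: cvgMr_tmp.
  by apply: cvg_expr; rewrite ger0_norm.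
have [l ul] : exists l, (fun n => nrm (u n - l)) @ \oo --> (0 : R).
  apply: bC => e e0; have [N NP] := (cvg0P _).1 qK0 e e0; exists N => m n.
  wlog mn : m n / (n <= m)%N.
    move=> h Nm Nn; case: (leqP n m) => [|/ltnW] mn; first exact: h.
    by rewrite (ip_normBC bP); exact: h.
  move=> Nm Nn; rewrite -(subnKC mn); apply: (le_lt_trans (udist _ _)).
  exact: le_lt_trans (ler_norm _) (NP _ Nn).
exists l; apply/eqP; rewrite -subr_eq0; apply/eqP/(ip_norm_eq0 bP)/eqP.
rewrite eq_le ip_norm_ge0 andbT; apply/ler_addgt0Pr => e e0; rewrite add0r.
have e20 : 0 < e / 2 by rewrite divr_gt0.
have [N NP] := (cvg0P _).1 ul _ e20.
have -> : l - E l - y = (l - u N.+1) + E (u N - l).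
  by rewrite /= (lin_mapB El) opprD !addrA -[in RHS](addrA _ _ (E (u N))) addNr addr0 addrAC.
apply: (le_trans (ip_normD bP _ _)); rewrite [e]splitr lerD//.
  rewrite (ip_normBC bP).
  by have /(_ (leqnSn N)) := NP N.+1; rewrite ger0_norm ?ip_norm_ge0// => /ltW.
apply: (le_trans (Eq _)); apply: (@le_trans _ _ (nrm (u N - l))).
  by rewrite ler_piMl ?ip_norm_ge0// ltW.
by have /(_ (leqnn N)) := NP N; rewrite ger0_norm ?ip_norm_ge0// => /ltW.
Qed.

(** Vectors u_n that represent l with an error tending to 0 form a Cauchy sequence,
    as one sees by testing with u_m - u_n; the limit represents l. This serves
    both the representation theorem and the coercivity of T. *)
Lemma represent_limit (u : nat -> V) (l : V -> C) (e : nat -> R) :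
  e @ \oo --> 0 ->
  (forall n x, cabs (b x (u n) - l x) <= e n * nrm x) ->
  exists z, (fun n => nrm (u n - z)) @ \oo --> 0 /\ forall x, l x = b x z.
Proof.
move=> e_cvg ul.
have udist m n : nrm (u m - u n) <= `|e m| + `|e n|.
  set x := u m - u n; have [x0|x0] := eqVneq x 0.
    by rewrite x0 (ip_norm0 bP) addr_ge0.
  rewrite -(ler_pM2r (ip_norm_gt0 bP x0)) -expr2 -(cabs_real (sqr_ge0 _)).
  rewrite (ip_normE bP) {2}/x (ipBr bP).
  have -> : b x (u m) - b x (u n) = (b x (u m) - l x) - (b x (u n) - l x).
    by rewrite opprB addrA subrK.
  apply: (le_trans (cabsD _ _)); rewrite cabsN mulrDl lerD//.
    by rewrite (le_trans (ul _ _))// ler_wpM2r ?ip_norm_ge0 ?ler_norm.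
  by rewrite (le_trans (ul _ _))// ler_wpM2r ?ip_norm_ge0 ?ler_norm.
have [z uz] : exists z, (fun n => nrm (u n - z)) @ \oo --> (0 : R).
  apply: bC => d d0; have d20 : 0 < d / 2 by rewrite divr_gt0.
  have [N NP] := (cvg0P _).1 e_cvg _ d20; exists N => m n Nm Nn.
  by rewrite (le_lt_trans (udist _ _))// [d]splitr ltrD ?NP.
exists z; split=> // x; apply/eqP; rewrite -subr_eq0; apply/eqP/cabs_eq0.
apply/eqP; rewrite eq_le cabs_ge0 andbT; apply/ler_addgt0Pr => d d0; rewrite add0r.
have k0 : 0 < 2 * (nrm x + 1) by rewrite mulr_gt0// ltr_wpDl ?ip_norm_ge0.
have dk0 : 0 < d / (2 * (nrm x + 1)) by rewrite divr_gt0.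
have [N NP] := (cvg0P _).1 e_cvg _ dk0.
have [N' NP'] := (cvg0P _).1 uz _ dk0.
set n := maxn N N'.
have -> : l x - b x z = - (b x (u n) - l x) + b x (u n - z).
  by rewrite opprB (ipBr bP) addrA subrK.
apply: (le_trans (cabsD _ _)); rewrite cabsN.
have h1 : cabs (b x (u n) - l x) <= d / (2 * (nrm x + 1)) * nrm x.
  rewrite (le_trans (ul _ _))// ler_wpM2r ?ip_norm_ge0//.
  by rewrite (le_trans (ler_norm _))// ltW// NP// leq_maxl.
have h2 : cabs (b x (u n - z)) <= nrm x * (d / (2 * (nrm x + 1))).
  rewrite (le_trans (cauchy_schwarz bP _ _))// ler_wpM2l ?ip_norm_ge0//.
  by rewrite (le_trans (ler_norm _))// ltW// NP'// leq_maxr.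
apply: (le_trans (lerD h1 h2)).
have nx10 : 0 < nrm x + 1 by rewrite ltr_wpDl ?ip_norm_ge0.
rewrite [X in X <= _](_ : _ = d * nrm x / (nrm x + 1)).
  by rewrite ler_pdivrMr// ler_wpM2l ?lerDl// ltW.
by field; exact: lt0r_neq0.
Qed.

(** An almost minimizer u of J(u) = |u|^2 - 2 Re l(u) represents l up to a small
    error: otherwise a step in some direction x would decrease J too much. *)
Lemma riesz_almost (l : V -> C) (M : R) : lin_map l -> 0 <= M ->
  (forall x, cabs (l x) <= M * nrm x) ->
  forall e, 0 < e -> exists u, forall x, cabs (b x u - l x) <= e * nrm x.
Proof.
move=> ll M0 lM e e0.
pose Jf u := nrm u ^+ 2 - 2 * complex.Re (l u).
pose S := range Jf.
(* completing the square, J is at least - M^2 *)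
have Slb : has_lbound S.
  exists (- M ^+ 2) => _ [u _ <-].
  have := le_trans (Re_le_cabs _) (lM u); rewrite /Jf.
  move: (complex.Re _) (nrm u) => r n h.
  have := sqr_ge0 (n - M); nra.
have S0 : S !=set0 by exists (Jf 0), 0.
have e20 : 0 < e ^+ 2 by rewrite exprn_gt0.
have [_ [u _ <-] uS] := inf_adherent e20 (Logic.conj S0 Slb).
exists u => x; have [->|x0] := eqVneq x 0.
  by rewrite (ip0l bP) (lin_map0 ll) subrr cabs0 (ip_norm0 bP) mulr0.
have nx := ip_norm_gt0 bP x0.
set d := b x u - l x.
(* the step along x that minimizes J *)
pose t := - conjc d / ((nrm x ^+ 2)%:C%C).
have Jt : Jf (u + t *: x) = Jf u - cabs d ^+ 2 / nrm x ^+ 2.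
  rewrite /Jf (ip_norm_sqrD bP) (lin_mapD ll) (lin_mapZ ll) (ip_normZ bP).
  have -> : complex.Re (b u (t *: x)) = complex.Re (t * b x u).
    by rewrite (ip_herm bP) (ipZl bP); case: (t * _).
  have -> : complex.Re (l u + t * l x) = complex.Re (l u) + complex.Re (t * l x).
    by case: (l u) (t * _) => ? ? [].
  have -> : complex.Re (t * b x u) = complex.Re (t * l x) + complex.Re (t * d).
    rewrite /d mulrBr; case: (t * b x u) (t * l x) => ? ? [? ?] /=.
    by rewrite addrC subrK.
  have -> : t * d = (- (cabs d ^+ 2 / nrm x ^+ 2))%:C%C.
    rewrite /t mulrAC mulNr (mulrC _ d) sqmodE rmorphN /= mulNr.
    by rewrite -real_complexV -rmorphM.
  have -> : cabs t = cabs d / nrm x ^+ 2.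
    rewrite /t cabsM cabsN cabs_conj; congr (_ * _).
    by rewrite -real_complexV cabs_real// invr_ge0 sqr_ge0.
  rewrite /= ; field; exact: lt0r_neq0.
have SJt : S (Jf (u + t *: x)) by exists (u + t *: x).
have := ge_inf Slb SJt; rewrite Jt lerBrDr.
move=> h; have {h} := le_lt_trans h uS; rewrite ltrD2l => /ltW.
rewrite ler_pdivrMr ?exprn_gt0// -exprMn ler_pXn2r// ?nnegrE ?cabs_ge0//.
by rewrite mulr_ge0 ?ip_norm_ge0// ltW.
Qed.

Lemma riesz (l : V -> C) (M : R) : lin_map l -> 0 <= M ->
  (forall x, cabs (l x) <= M * nrm x) -> exists z, forall x, l x = b x z.
Proof.
move=> ll M0 lM.
have inv0 n : 0 < (n.+1%:R : R)^-1 by [].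
have [u uP] := choice (fun n => riesz_almost ll M0 lM (inv0 n)).
by have [z [_ zP]] := represent_limit (@cvg_harmonic R) uP; exists z.
Qed.

End completeness.

(** * The preconditioned equation in a Hilbert space *)

Section singular_values.
Variable R : realType.
Notation C := R[i].
Variables (V : lmodType C) (b : V -> V -> C) (bP : inner_product b).
Notation nrm := (ip_norm b).

Lemma eq_approx_le (L L' : V -> V) j s :
  (forall x, L x = L' x) -> approx_le b L j s -> approx_le b L' j s.
Proof.
move=> LL' h e e0; have [L1 [L1l L1r L1P]] := h e e0.
by exists L1; split=> // x; rewrite -LL'.
Qed.

Lemma approx_le_comp (Q L : V -> V) j s k : lin_map Q -> 0 < k ->
  (forall y, nrm (Q y) <= k * nrm y) ->
  approx_le b L j s -> approx_le b (Q \o L) j (k * s).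
Proof.
move=> Ql k0 Qk Lj e e0; have [|L' [L'l [m [v [mj L'v]]] L'P]] := Lj (e / k).
  exact: divr_gt0.
exists (Q \o L'); split; first exact: lin_map_comp.
  exists m, (Q \o v); split=> // x; have [c cE] := L'v x.
  by exists c; rewrite /= cE (lin_map_sum Ql).
move=> x /=; rewrite -(lin_mapB Ql) (le_trans (Qk _))//.
rewrite [e](_ : _ = k * (e / k)); last by field; exact: lt0r_neq0.
by rewrite -mulrDr -mulrA ler_wpM2l// ltW.
Qed.

Lemma approx_le_id_add (L : V -> V) j s :
  approx_le b L j s -> approx_le b (fun x => x + L x) j (1 + s).
Proof.
move=> Lj e e0; have [L' [L'l L'r L'P]] := Lj e e0.
exists L'; split=> // x; rewrite -addrA (le_trans (ip_normD bP _ _))//.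
by rewrite -[1 + s + e]addrA mulrDl mul1r lerD2l.
Qed.

(** Maps of rank less than 1 vanish, so the first approximation number is the
    operator norm. *)
Lemma approx_le1 (L : V -> V) s x : approx_le b L 1 s -> nrm (L x) <= s * nrm x.
Proof.
move=> Ls; apply/ler_addgt0Pr => e e0.
have n1 : 0 < nrm x + 1 by rewrite ltr_wpDl ?ip_norm_ge0.
have [|L' [_ [m [v [m1 L'v]]] L'P]] := Ls (e / (nrm x + 1)).
  exact: divr_gt0.
have L'x : L' x = 0.
  by have [c ->] := L'v x; case: m m1 v L'v c => // *; rewrite big_ord0.
have := L'P x; rewrite L'x subr0 => /le_trans; apply.
rewrite mulrDl lerD2l mulrAC ler_pdivrMr// ler_wpM2l ?(ltW e0)//.
by rewrite lerDl.
Qed.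

Variables (D : V -> V) (D_bl : bounded_linear nrm nrm D).

Let zero_map j : (0 < j)%N -> bounded_linear nrm nrm (fun _ : V => 0 : V) /\
  rank_lt j (fun _ : V => 0 : V).
Proof.
move=> j0; split.
  split; first by move=> a x y; rewrite scaler0 addr0.
  by exists 0 => x; rewrite mul0r (ip_norm0 bP).
by exists 0, (fun _ => 0); split=> // x; exists (fun _ => 0); rewrite big_ord0.
Qed.

Lemma singular_value_ge0 j : (0 < j)%N -> 0 <= singular_value nrm j D.
Proof.
move=> j0; apply: lb_le_inf; last by move=> _ [L' _ <-]; exact: opnorm_ge0.
by eexists; exists (fun _ => 0); [exact: zero_map|].
Qed.

(** Boundedness of D and of the approximants turns the operator norm of D - L'
    into a pointwise inequality. *)
Lemma singular_valueP j : (0 < j)%N -> approx_le b D j (singular_value nrm j D).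
Proof.
move=> j0 e e0; rewrite /singular_value.
set S := [set opnorm _ _ _ | _ in _].
have Si : has_inf S.
  split; first by eexists; exists (fun _ => 0); [exact: zero_map|].
  by exists 0 => _ [L' _ <-]; exact: opnorm_ge0.
have [_ [L' [[L'l [M' L'M]] L'r] <-] L'S] := inf_adherent e0 Si.
exists L'; split=> // x.
have [_ [M DM]] := D_bl.
apply: (@le_trans _ _ (opnorm nrm nrm (fun x => D x - L' x) * nrm x)).
  apply: (@le_opnorm _ _ _ nrm nrm _ (fun x => D x - L' x)).
    exact: ip_norm_ge0.
  exists (M + M') => y; rewrite (le_trans (ip_normB bP _ _))//.
  by rewrite mulrDl lerD.
by rewrite ler_wpM2r ?ip_norm_ge0// ltW.
Qed.

End singular_values.

Section preconditioned_gmres.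
Variable R : realType.
Notation C := R[i].
Variables (V : lmodType C) (b : V -> V -> C) (bP : inner_product b).
Notation nrm := (ip_norm b).
Hypothesis bC : norm_complete nrm.
Variables (Pi S Sr : V -> V).
Hypotheses (Pi_lin : lin_map Pi) (Pi_le : forall p, nrm (Pi p) <= nrm p).
Hypotheses (S_lin : lin_map S) (S_le : forall p, nrm (S p) <= nrm p).
Hypothesis Sr_bl : bounded_linear nrm nrm Sr.
Let G p := p + Pi (S p).
Let Gr p := p + Pi (Sr p).
Let D p := S p - Sr p.
Hypothesis G_bij : bijective G.
Let gam := lower_bound nrm G.
Let sig j := singular_value nrm j D.
Hypothesis sig_lt : sig 1%N < gam.

Let Sr_lin : lin_map Sr := proj1 Sr_bl.

Let D_bl : bounded_linear nrm nrm D.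
Proof.
have [_ [M SrM]] := Sr_bl; split.
  by move=> a x y; rewrite /D S_lin Sr_lin scalerBr opprD addrACA.
exists (1 + M) => x; rewrite mulrDl mul1r.
by rewrite (le_trans (ip_normB bP _ _))// lerD.
Qed.

Let D_lin : lin_map D := proj1 D_bl.

Let G_lin : lin_map G.
Proof. by move=> a x y; rewrite /G S_lin Pi_lin scalerDr addrACA. Qed.

Let Gr_lin : lin_map Gr.
Proof. by move=> a x y; rewrite /Gr Sr_lin Pi_lin scalerDr addrACA. Qed.

Let GrE p : Gr p = G p - Pi (D p).
Proof. by rewrite /Gr /G /D (lin_mapB Pi_lin) opprB -addrA [Pi (S p) + _]addrC subrK. Qed.

Let sig_ge0 j : (0 < j)%N -> 0 <= sig j.
Proof. exact: singular_value_ge0. Qed.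

Let sig1 p : nrm (D p) <= sig 1%N * nrm p.
Proof. by apply: approx_le1; exact: singular_valueP. Qed.

Let gam_gt0 : 0 < gam := le_lt_trans (sig_ge0 (ltnSn 0)) sig_lt.

Let dif_gt0 : 0 < gam - sig 1%N.
Proof. by rewrite subr_gt0. Qed.

Let G_ge p : gam * nrm p <= nrm (G p).
Proof.
have [->|p0] := eqVneq p 0; first by rewrite (ip_norm0 bP) mulr0 ip_norm_ge0.
rewrite -ler_pdivlMr ?(ip_norm_gt0 bP)//; apply: ge_inf; last by exists p.
by exists 0 => _ [q _ <-]; rewrite divr_ge0 ?ip_norm_ge0.
Qed.

Let Gr_ge p : (gam - sig 1%N) * nrm p <= nrm (Gr p).
Proof.
have -> : (gam - sig 1%N) * nrm p = gam * nrm p - sig 1%N * nrm p by rewrite mulrBl.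
rewrite lerBlDr (le_trans (G_ge p))//.
have -> : G p = Gr p + Pi (D p) by rewrite GrE subrK.
rewrite (le_trans (ip_normD bP _ _))// lerD2l.
exact: le_trans (Pi_le _) (sig1 _).
Qed.

Let Gi := op_inv G.
Let Gi_lin : lin_map Gi := lin_map_op_inv G_lin G_bij.

Let Gi_le p : nrm (Gi p) <= gam^-1 * nrm p.
Proof. by rewrite mulrC ler_pdivlMr// mulrC (le_trans (G_ge _))// op_invK. Qed.

(** Gr = G (Id - G^-1 Pi D), where G^-1 Pi D is a strict contraction since its norm
    is at most sigma_1 / gamma. *)
Lemma Id_plus_Pi_approx_bijective : bijective Gr.
Proof.
have GiPiD_lin : lin_map (fun p => Gi (Pi (D p))).
  by move=> a x y; rewrite D_lin Pi_lin Gi_lin.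
have q01 : 0 <= gam^-1 * sig 1%N < 1.
  by rewrite mulr_ge0 ?invr_ge0 ?(ltW gam_gt0) ?sig_ge0//= mulrC ltr_pdivrMr ?mul1r.
have le_q p : nrm (Gi (Pi (D p))) <= gam^-1 * sig 1%N * nrm p.
  rewrite (le_trans (Gi_le _))// -mulrA ler_wpM2l ?invr_ge0 ?(ltW gam_gt0)//.
  exact: le_trans (Pi_le _) (sig1 _).
have Gr_surj y : exists x, Gr x = y.
  have [x xE] := neumann_surjective bP bC GiPiD_lin q01 le_q (Gi y).
  exists x; rewrite GrE -[y](op_invK G_bij) -/Gi -xE (lin_mapB G_lin).
  by rewrite op_invK.
have [h hK] := choice Gr_surj; exists h => // x.
apply: (lin_map_inj Gr_lin); last by rewrite hK.
move=> y y0; apply: (ip_norm_eq0 bP); apply/eqP; rewrite eq_le ip_norm_ge0 andbT.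
by have := Gr_ge y; rewrite y0 (ip_norm0 bP) pmulr_rle0.
Qed.

Let Gr_bij := Id_plus_Pi_approx_bijective.
Let P := op_inv Gr.
Let P_lin : lin_map P := lin_map_op_inv Gr_lin Gr_bij.

Let P_le p : nrm (P p) <= (gam - sig 1%N)^-1 * nrm p.
Proof. by rewrite mulrC ler_pdivlMr// mulrC (le_trans (Gr_ge _))// op_invK. Qed.

Let Gr_le p : nrm (Gr p) <= (2 + sig 1%N) * nrm p.
Proof.
rewrite GrE (le_trans (ip_normB bP _ _))// mulrDl lerD//.
  rewrite (le_trans (ip_normD bP _ _))// mulrDl mul1r lerD2l.
  exact: le_trans (Pi_le _) (S_le _).
exact: le_trans (Pi_le _) (sig1 _).
Qed.

(** Combines [gmres_bound] with the bounds for the approximation numbers of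
    M - Id = P Pi D and of M^-1 = Id - G^-1 Pi D, where P = Gr^-1 and M = P G. *)
Lemma preconditioned_gmres_bound (F p0 pn : V) n :
  is_gmres_iterate nrm (fun p => P (G p)) (P F) p0 n pn ->
  F - G p0 != 0 ->
  nrm (F - G pn) / nrm (F - G p0) <=
  (2 + sig 1%N) / (gam - sig 1%N) *
  \prod_(1 <= j < n.+1)
    (sig j / gam * (1 + sig j / gam) * (1 - sig 1%N / gam)^-1).
Proof.
move=> pn_gmres r0.
pose s j := (gam - sig 1%N)^-1 * sig j.
pose t j := 1 + gam^-1 * sig j.
have s_ge0 j : (0 < j)%N -> 0 <= s j.
  by move=> j0; rewrite mulr_ge0 ?invr_ge0 ?sig_ge0// ltW.
have t_ge0 j : (0 < j)%N -> 0 <= t j.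
  by move=> j0; rewrite addr_ge0// mulr_ge0 ?invr_ge0 ?sig_ge0// ltW.
have sP j : (0 < j)%N -> approx_le b (fun p => P (G p) - p) j (s j).
  move=> j0; apply: (@eq_approx_le _ _ _ ((P \o Pi) \o D)).
    move=> p /=; rewrite -[X in _ = _ - X](op_invKr Gr_bij p) -/P -(lin_mapB P_lin).
    by rewrite GrE subKr.
  apply: approx_le_comp; [exact: lin_map_comp|by rewrite invr_gt0| |].
    move=> y /=; rewrite (le_trans (P_le _))// ler_wpM2l ?invr_ge0 ?(ltW dif_gt0)//.
  exact: singular_valueP.
have tP j : (0 < j)%N -> approx_le b (Gi \o Gr) j (t j).
  move=> j0; apply: (@eq_approx_le _ _ _ (fun p => p + ((fun p => - Gi (Pi p)) \o D) p)).
    by move=> p /=; rewrite GrE (lin_mapB Gi_lin) /Gi op_invKr.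
  apply: approx_le_id_add => //; apply: approx_le_comp.
  - by move=> a x y; rewrite Pi_lin Gi_lin opprD scalerN.
  - by rewrite invr_gt0.
  - move=> y; rewrite (ip_normN bP) (le_trans (Gi_le _))//.
    by rewrite ler_wpM2l ?invr_ge0 ?(ltW gam_gt0).
  - exact: singular_valueP.
have M_lin : lin_map (fun p => P (G p)) := lin_map_comp G_lin P_lin.
have Minv_lin : lin_map (Gi \o Gr) := lin_map_comp Gr_lin Gi_lin.
have MK : cancel (fun p => P (G p)) (Gi \o Gr).
  by move=> p; rewrite /= /P /Gi op_invK// op_invKr.
have := gmres_bound bP M_lin Minv_lin MK
  (fun j (jn : (0 < j <= n)%N) => Logic.conj (s_ge0 j (proj1 (andP jn))) (sP j (proj1 (andP jn))))
  (fun j (jn : (0 < j <= n)%N) => Logic.conj (t_ge0 j (proj1 (andP jn))) (tP j (proj1 (andP jn))))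
  pn_gmres.
rewrite -!(lin_mapB P_lin) => le_gmres.
have -> : \prod_(1 <= j < n.+1)
    (sig j / gam * (1 + sig j / gam) * (1 - sig 1%N / gam)^-1)
    = \prod_(1 <= j < n.+1) (s j * t j).
  apply: eq_bigr => j _; rewrite /s /t; field.
  by rewrite !lt0r_neq0.
rewrite ler_pdivrMr ?(ip_norm_gt0 bP)//.
rewrite -[F - G pn](op_invK Gr_bij) (le_trans (Gr_le _))//.
have sig20 : 0 <= 2 + sig 1%N by rewrite addr_ge0// sig_ge0.
rewrite -!mulrA.
rewrite ler_wpM2l// (le_trans le_gmres)// mulrCA mulrC ler_wpM2l//.
rewrite big_nat; apply: prodr_ge0 => j /andP[j0 _].
by rewrite mulr_ge0 ?s_ge0 ?t_ge0.
Qed.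

End preconditioned_gmres.

(** * The scalar product induced by the impedance operator *)

Section hilbert_product_complete.
Variables (R : realType) (I : finType) (V : I -> innerSpace R).

(** The norm of a product dominates that of each component, and is a continuous
    function of them. *)
Lemma hprod_complete : (forall i, hcomplete (V i)) -> hcomplete (hprod V).
Proof.
move=> Vc u uC.
have hi (x : hprod V) i : hnorm (x i) <= hnorm x.
  rewrite ler_sqrt; last first.
    by rewrite -(ip_norm_sqr (dot_inner_product (hprod V))) sqr_ge0.
  rewrite /= (bigD1 i)//= raddfD /= lerDl raddf_sum sumr_ge0// => j _.
  have := sqr_ge0 (hnorm (x j)).
  by rewrite (ip_norm_sqr (dot_inner_product (V j))).
have ui i : exists l : V i, (fun n => hnorm (u n i - l)) @ \oo --> (0 : R).
  apply: Vc => e e0; have [N NP] := uC e e0; exists N => m n Nm Nn.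
  exact: le_lt_trans (hi (u m - u n) i) (NP _ _ Nm Nn).
pose l : hprod V := fun i => projT1 (cid (ui i)).
have lP i : (fun n => hnorm (u n i - l i)) @ \oo --> (0 : R) := projT2 (cid (ui i)).
exists l.
have -> : (fun n => hnorm (u n - l)) =
    Num.sqrt \o (fun n => \sum_i hnorm (u n i - l i) ^+ 2).
  apply/funext => n /=; congr Num.sqrt; rewrite /= raddf_sum.
  by apply: eq_bigr => i _; rewrite /= -(ip_norm_sqr (dot_inner_product (V i))).
rewrite -[X in _ --> X](@sqrtr0 R); apply: continuous_cvg; first exact: sqrt_continuous.
elim: (index_enum I) => [|i r IH].
  by under eq_fun => n do rewrite big_nil; exact: cvg_cst.
have -> : (fun n => \sum_(j <- i :: r) hnorm (u n j - l j) ^+ 2) =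
    (fun n => hnorm (u n i - l i) ^+ 2 + \sum_(j <- r) hnorm (u n j - l j) ^+ 2).
  by apply/funext => n; rewrite big_cons.
rewrite -[X in _ --> X]addr0; apply: cvgD => //.
have -> : (fun n => hnorm (u n i - l i) ^+ 2) =
    (fun n => hnorm (u n i - l i) * hnorm (u n i - l i)) by [].
by rewrite -[X in _ --> X](mulr0 0); apply: cvgM.
Qed.

End hilbert_product_complete.

Section dual_space_facts.
Variable R : realType.
Notation C := R[i].
Variable H : innerSpace R.

Lemma dualE (a : C) (l m : dual H) x : (a *: l + m) x = a * l x + m x.
Proof. by []. Qed.

Lemma dualD (l m : dual H) x : (l + m) x = l x + m x.
Proof. by []. Qed.

Lemma dualN (l : dual H) x : (- l) x = - l x.
Proof. by []. Qed.

Lemma dualP (l m : dual H) : (forall x, l x = m x) -> l = m.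
Proof. by move=> lm; apply: val_inj; apply/funext. Qed.

Lemma dual_lin (l : dual H) a x y : l (a *: x + y) = a * l x + l y.
Proof. by case: l => l /= /asboolP[ll _]; exact: ll. Qed.

Lemma le_dnorm (l : dual H) x : cabs (l x) <= dnorm l * hnorm x.
Proof.
by apply: le_opnorm; [exact: hnorm_ge0|case: l => l /= /asboolP[]].
Qed.

Lemma dnorm_ge0 (l : dual H) : 0 <= dnorm l.
Proof. exact: opnorm_ge0. Qed.

Lemma hnorm_conj (x : H) : hnorm (conj x) = hnorm x.
Proof. by rewrite /hnorm dot_conj; case: (dot x x). Qed.

End dual_space_facts.

Section dual_form.
Variable R : realType.
Notation C := R[i].
Variables (H : innerSpace R) (T : bop (@hnorm R H) (@dnorm R H)).
Hypotheses (T_adj : self_adjoint T) (T_pos : positive_definite T).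

Let T_lin : lin_map T := proj1 (bopP T).

Definition tform (p q : H) : C := T p (conj q).

Lemma tform_inner_product : inner_product tform.
Proof.
split=> [a x y z|x y|x x0]; first by rewrite /tform T_lin dualE.
  exact: T_adj.
exact: T_pos.
Qed.

Let tP := tform_inner_product.

Hypothesis T_bij : bijective T.
Let Ti_lin : lin_map (op_inv T) := lin_map_op_inv T_lin T_bij.

(** The scalar product of the norm T^-1: that of T, transported along T. *)
Definition dform (p q : dual H) : C := tform (op_inv T p) (op_inv T q).

Lemma dform_inner_product : inner_product dform.
Proof.
split=> [a x y z|x y|x x0].
- by rewrite /dform Ti_lin (ip_linear tP).
- exact: (ip_herm tP).
- apply: (ip_gt0 tP); apply: contra_neq x0 => h.
  by rewrite -(op_invK T_bij x) h (lin_map0 T_lin).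
Qed.

Lemma dformE p q : dform p q = p (conj (op_inv T q)).
Proof. by rewrite /dform /tform op_invK. Qed.

Lemma Tinv_normE : Tinv_norm T = ip_norm dform.
Proof.
apply/funext => p; rewrite /Tinv_norm /ip_norm dformE /dconj.
by case: (p _).
Qed.

End dual_form.

Section impedance.
Variable R : realType.
Notation C := R[i].
Variable H : innerSpace R.
Variables (Hc : hcomplete H) (T Tp : bop (@hnorm R H) (@dnorm R H)).
Hypotheses (T_adj : self_adjoint T) (T_pos : positive_definite T).
Hypotheses (Tp_dot : forall p q, dot p q = Tp p (conj q)).
Hypotheses (T_compact : compact_op (fun p => T p - Tp p)).
Notation tform := (tform T).
Notation dform := (dform T).

Let T_lin : lin_map T := proj1 (bopP T).
Let tP := tform_inner_product T_adj T_pos.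
Let hP := dot_inner_product H.

Lemma tnorm_le : exists2 k, 0 < k & forall p, ip_norm tform p <= k * hnorm p.
Proof.
have [_ [M TM]] := bopP T; exists (Num.sqrt (`|M| + 1)).
  by rewrite sqrtr_gt0 ltr_wpDl.
move=> p; rewrite -(@ler_pXn2r R 2) ?nnegrE ?mulr_ge0 ?sqrtr_ge0 ?hnorm_ge0//.
rewrite (ip_norm_sqr tP) exprMn sqr_sqrtr ?addr_ge0//.
apply: (le_trans (Re_le_cabs _)); apply: (le_trans (le_dnorm _ _)).
rewrite hnorm_conj expr2 mulrA ler_wpM2r ?hnorm_ge0//.
by rewrite (le_trans (TM p))// ler_wpM2r ?hnorm_ge0// ler_wpDr// ler_norm.
Qed.

(** Otherwise some u_n of norm 1 have tnorm tending to 0. Then T u_n tends to 0,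
    hence so does, along a subsequence, Tp u_n plus a fixed functional, by
    compactness of T - Tp. As Tp is the Riesz map, u_n converges by
    [represent_limit]; the limit is 0 since its tnorm vanishes, although the u_n
    have norm 1. *)
Lemma tnorm_coercive : exists2 k, 0 < k & forall p, hnorm p <= k * ip_norm tform p.
Proof.
have [k k0 tk] := tnorm_le.
apply: contrapT => noc.
have seqP (n : nat) : exists p, hnorm p = 1 /\ ip_norm tform p <= n.+1%:R^-1.
  (* [noc] applied to the constant n.+1 *)
  have [p pP] : exists p, n.+1%:R * ip_norm tform p < hnorm p.
    apply: contrapT => h; apply: noc; exists n.+1%:R => // p.
    by rewrite leNgt; apply/negP => hp; apply: h; exists p.
  have p0 : 0 < hnorm p by rewrite (le_lt_trans _ pP)// mulr_ge0// ip_norm_ge0.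
  exists ((hnorm p)^-1%:C%C *: p); split.
    rewrite [hnorm _](ip_normZ hP) cabs_real ?invr_ge0 ?hnorm_ge0//.
    by rewrite mulVf// gt_eqF.
  rewrite (ip_normZ tP) cabs_real ?invr_ge0 ?hnorm_ge0//.
  by rewrite mulrC ler_pdivrMr// mulrC ler_pdivlMr// mulrC ltW.
have [u uP] := choice seqP.
have u1 n : hnorm (u n) = 1 := proj1 (uP n).
have ut n : ip_norm tform (u n) <= n.+1%:R^-1 := proj2 (uP n).
have [|ks [l0 [ks_incr Ku]]] := T_compact (x := u).
  by exists 1 => n; rewrite u1.
have ks_ge n : (n <= ks n)%N.
  by elim: n => // n IH; rewrite (leq_ltn_trans IH)// ks_incr.
pose d n : dual H := T (u (ks n)) - Tp (u (ks n)) - l0.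
pose e n := n.+1%:R^-1 * k + dnorm (d n).
have e_cvg : e @ \oo --> 0.
  rewrite -[X in _ --> X]addr0; apply: cvgD => //.
  rewrite -[X in _ --> X](mul0r k); apply: cvgMr_tmp; exact: cvg_harmonic.
have [|z [uz _]] := represent_limit hP Hc (u := u \o ks)
    (l := fun x => conjc (- l0 (conj x))) e_cvg.
  move=> n x /=; rewrite (dot_herm _ x) Tp_dot -rmorphB /= cabs_conj opprK.
  have -> : Tp (u (ks n)) (conj x) + l0 (conj x) =
      T (u (ks n)) (conj x) - d n (conj x).
    by rewrite /d !dualD !dualN !opprD !opprK !addrA subrr add0r.
  apply: (le_trans (cabsD _ _)); rewrite cabsN mulrDl lerD//.
    apply: (le_trans (cauchy_schwarz tP _ _)).
    rewrite -mulrA ler_pM ?ip_norm_ge0 ?tk//.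
    by rewrite (le_trans (ut _))// lef_pV2 ?posrE// ler_nat ltnS.
  by rewrite (le_trans (le_dnorm _ _))// hnorm_conj.
have z0 : z = 0.
  apply: (ip_norm_eq0 tP); apply/eqP; rewrite eq_le ip_norm_ge0 andbT.
  apply/ler_addgt0Pr => a a0; rewrite add0r.
  have ak : 0 < a / 2 / k by rewrite !divr_gt0.
  have a2 : 0 < a / 2 by rewrite divr_gt0.
  have [N NP] := (cvg0P _).1 uz _ ak.
  have [N' NP'] := (cvg0P _).1 (@cvg_harmonic R) _ a2.
  pose n := maxn N N'.
  have -> : z = u (ks n) - (u (ks n) - z) by rewrite opprB addrC subrK.
  apply: (le_trans (ip_normB tP _ _)); rewrite [a]splitr lerD//.
    rewrite (le_trans (ut _))//; apply: (@le_trans _ _ n.+1%:R^-1).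
      by rewrite lef_pV2 ?posrE// ler_nat ltnS.
    by rewrite (le_trans (ler_norm _))// ltW// NP'// leq_maxr.
  rewrite (le_trans (tk _))// mulrC -ler_pdivlMr// (le_trans (ler_norm _))//.
  by rewrite ltW// NP// leq_maxl.
have [N /(_ _ (leqnn N))] := (cvg0P _).1 uz _ ltr01.
by rewrite z0 /= subr0 [ip_norm _ _]u1 normr1 ltxx.
Qed.

Lemma tnorm_complete : norm_complete (ip_norm tform).
Proof.
have [k k0 tk] := tnorm_le; have [k' k'0 kt] := tnorm_coercive.
move=> u uC; have [|l ul] := Hc (u := u).
  move=> e e0; have [|N NP] := uC (e / k'); first exact: divr_gt0.
  exists N => m n Nm Nn; apply: (le_lt_trans (kt _)).
  by rewrite mulrC -ltr_pdivlMr// NP.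
exists l; apply/cvg0P => e e0.
have [|N NP] := (cvg0P _).1 ul (e / k); first exact: divr_gt0.
exists N => n Nn; rewrite ger0_norm ?ip_norm_ge0//.
apply: (le_lt_trans (tk _)); rewrite mulrC -ltr_pdivlMr//.
exact: le_lt_trans (ler_norm _) (NP _ Nn).
Qed.

(** The representation theorem is applied in the scalar product of T, which is
    complete by coercivity; conjugations turn a functional that is linear into
    the form x |-> < x, z > and back. *)
Lemma impedance_bijective : bijective T.
Proof.
have [k' k'0 kt] := tnorm_coercive.
have Tsurj (l : dual H) : exists z, T z = l.
  have [|||z zP] := riesz tP tnorm_complete (l := fun y => conjc (l (conj y)))
     (M := dnorm l * k').
  - move=> a x y; rewrite (@conj_antilinear R H) dual_lin rmorphD rmorphM /=.
    by rewrite conjcK.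
  - by rewrite mulr_ge0 ?dnorm_ge0// ltW.
  - move=> x; rewrite cabs_conj (le_trans (le_dnorm _ _))// hnorm_conj -mulrA.
    by rewrite ler_wpM2l ?dnorm_ge0.
  exists z; apply: dualP => x; have := zP (conj x).
  rewrite (ip_herm tP) /tform !conjK => /(congr1 (@conjc R)).
  by rewrite !conjcK.
have [g gP] := choice Tsurj; exists g => // x.
have T0 y : T y = 0 -> y = 0 by move=> Ty; apply: (ip_eq0 tP); rewrite /tform Ty.
by apply: (lin_map_inj T_lin T0); rewrite gP.
Qed.

Let T_bij := impedance_bijective.
Let Ti_lin : lin_map (op_inv T) := lin_map_op_inv T_lin T_bij.
Let dP := dform_inner_product T_adj T_pos T_bij.

Lemma Tinv_complete : norm_complete (ip_norm dform).
Proof.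
move=> u uC; have [|l ul] := tnorm_complete (u := op_inv T \o u).
  move=> e e0; have [N NP] := uC e e0; exists N => m n Nm Nn /=.
  by rewrite -(lin_mapB Ti_lin); exact: NP.
exists (T l); apply/cvg0P => e e0; have [N NP] := (cvg0P _).1 ul e e0.
exists N => n Nn; have := NP n Nn.
by rewrite /ip_norm /dform (lin_mapB Ti_lin) (op_invKr T_bij).
Qed.

Lemma dnorm_equiv : exists2 k, 0 < k & forall p,
  dnorm p <= k * ip_norm dform p /\ ip_norm dform p <= k * dnorm p.
Proof.
have [k k0 tk] := tnorm_le; have [k' k'0 kt] := tnorm_coercive.
exists (k + k'); first exact: addr_gt0.
move=> p; split.
  apply: opnorm_le; first by rewrite mulr_ge0 ?ip_norm_ge0// ltW ?addr_gt0.
  move=> x; have -> : p x = tform (op_inv T p) (conj x).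
    by rewrite /tform op_invK// conjK.
  apply: (le_trans (cauchy_schwarz tP _ _)).
  rewrite [X in _ <= X]mulrAC [X in _ <= X]mulrC ler_wpM2l ?ip_norm_ge0//.
  apply: (le_trans (tk _)); rewrite hnorm_conj ler_wpM2r ?hnorm_ge0//.
  by rewrite lerDl ltW.
have [->|p0] := eqVneq p 0.
  by rewrite (ip_norm0 dP) mulr_ge0 ?dnorm_ge0// ltW ?addr_gt0.
rewrite -(ler_pM2r (ip_norm_gt0 dP p0)) -expr2.
rewrite (ip_norm_sqr dP) (dformE T_bij).
apply: (le_trans (Re_le_cabs _)); apply: (le_trans (le_dnorm _ _)).
rewrite hnorm_conj mulrAC mulrC ler_wpM2r ?dnorm_ge0//.
apply: (le_trans (kt _)); rewrite ler_wpM2r ?ip_norm_ge0//.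
by rewrite lerDr ltW.
Qed.

End impedance.

(** * Exchange and scattering operators *)

Section exchange_scattering.
Variable R : realType.
Notation C := R[i].
Variables (HO HS HSk : innerSpace R).
Variables (A : bop (@hnorm R HO) (@dnorm R HO)) (B : bop (@hnorm R HO) (@hnorm R HS)).
Variables (T : bop (@hnorm R HS) (@dnorm R HS)) (Rr : bop (@hnorm R HSk) (@hnorm R HS)).
Hypotheses (T_adj : self_adjoint T) (T_pos : positive_definite T) (T_bij : bijective T).

Let T_lin : lin_map T := proj1 (bopP T).
Let dP := dform_inner_product T_adj T_pos T_bij.

Lemma lin_map_adj (H K : innerSpace R) (L : bop (@hnorm R H) (@hnorm R K)) :
  lin_map (adj L).
Proof. by move=> a x y; apply: dualP. Qed.

Lemma lin_map_exchange : bijective (RTR T Rr) -> lin_map (exchange T Rr).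
Proof.
move=> RTR_bij.
have RTR_lin : lin_map (RTR T Rr).
  by move=> a x y; rewrite /RTR (proj1 (bopP Rr)) T_lin lin_map_adj.
move=> a x y; rewrite /exchange lin_map_adj (lin_map_op_inv RTR_lin RTR_bij).
rewrite (proj1 (bopP Rr)) T_lin scalerDr opprD addrACA scalerBr; congr (_ - _ + _).
by rewrite !scalerA mulrC.
Qed.

(** With w = T R (R^* T R)^-1 R^* p one has < p, w > = < w, w >, that is, w is an
    orthogonal projection of p, and 2 w - p is the image of p by the
    corresponding reflection. That R is real is used to pass from the bilinear
    pairing to the scalar product. *)
Lemma exchange_isometry : bijective (RTR T Rr) ->
  (forall v, Rr (conj v) = conj (Rr v)) ->
  forall p, ip_norm (dform T) (exchange T Rr p) = ip_norm (dform T) p.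
Proof.
move=> RTR_bij Rr_conj p; rewrite /exchange.
set v := op_inv _ _; set w := T (Rr v).
have pw : dform T p w = dform T w w.
  rewrite !dformE// /w op_invKr// -Rr_conj.
  by rewrite -[LHS]/(adj Rr p (conj v)) -[adj Rr p](op_invK RTR_bij).
have ww : conjc (dform T w w) = dform T w w by rewrite -(ip_herm dP).
have wp : dform T w p = dform T w w by rewrite (ip_herm dP) pw ww.
rewrite /ip_norm; congr (Num.sqrt (complex.Re _)).
rewrite (ipBl dP) !(ipBr dP) !(ipZl dP) !(ipZr dP) pw wp rmorph_nat.
ring.
Qed.

Lemma lin_map_scatter : bijective (AiBTB A B T) -> lin_map (scatter A B T).
Proof.
move=> Z_bij.
have Z_lin : lin_map (AiBTB A B T).
  move=> a x y; rewrite /AiBTB (proj1 (bopP A)) (proj1 (bopP B)) T_lin lin_map_adj.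
  by rewrite !scalerBr scalerDr opprD addrACA !scalerA mulrC.
move=> a x y; rewrite /scatter lin_map_adj (lin_map_op_inv Z_lin Z_bij).
rewrite (proj1 (bopP B)) T_lin !scalerDr addrACA; congr (_ + _ + _).
by rewrite !scalerA mulrC.
Qed.

(** With u = (A - i B^* T B)^-1 B^* p, energy conservation reads
      |S p|^2 = |p|^2 + 4 Im < A u, conj u >. *)
Lemma scatter_contraction : bijective (AiBTB A B T) ->
  (forall u, B (conj u) = conj (B u)) ->
  (forall u, complex.Im (A u (conj u)) <= 0) ->
  forall p, ip_norm (dform T) (scatter A B T p) <= ip_norm (dform T) p.
Proof.
move=> Z_bij B_conj A_diss p; rewrite /scatter.
set u := op_inv _ _; set w := T (B u).
have pw : dform T p w = A u (conj u) - 'i%C * dform T w w.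
  rewrite !dformE// /w op_invKr// -B_conj.
  by rewrite -[LHS]/(adj B p (conj u)) -[adj B p](op_invK Z_bij).
have ww : conjc (dform T w w) = dform T w w by rewrite -(ip_herm dP).
have wp : dform T w p = conjc (dform T p w) by rewrite (ip_herm dP).
rewrite /ip_norm ler_wsqrtr//.
rewrite !(ipDl dP) !(ipDr dP) !(ipZl dP) !(ipZr dP) wp pw.
have := A_diss u; case: (A u (conj u)) => a1 a2 /= a20.
have := ww; case: (dform T w w) => t1 t2 [t20].
have {t20} -> : t2 = 0 by lra.
by case: (dform T p p) => p1 p2 /=; lra.
Qed.

End exchange_scattering.

(** * Complex conjugation in Sobolev and trace spaces *)

Section complex_integrals.
Variable R : realType.
Notation C := R[i].

Lemma Re_conjc (z : C) : complex.Re (conjc z) = complex.Re z.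
Proof. by case: z. Qed.

Lemma Im_conjc (z : C) : complex.Im (conjc z) = - complex.Im z.
Proof. by case: z. Qed.

Lemma sqmod_conjc (z : C) : sqmod (conjc z) = sqmod z.
Proof. by rewrite /sqmod Re_conjc Im_conjc sqrrN. Qed.

Variables (dd : measure_display) (T : measurableType dd).
Variables (mu : {measure set T -> \bar R}) (D : set T).

(** This holds for every function: when the positive and negative parts both have
    infinite integrals, the real-valued integral is 0, whatever the sign. *)
Lemma Rintegral_opp (f : T -> R) :
  \int[mu]_(x in D) (- f x) = - \int[mu]_(x in D) f x.
Proof.
rewrite /Rintegral; set g := EFin \o f.
rewrite [X in fine X](_ : _ = (\int[mu]_(x in D) (\- g) x)%E); last first.
  by apply: eq_integral => x _; rewrite /g /= EFinN.
rewrite [X in - fine X](_ : _ = (\int[mu]_(x in D) g x)%E)//.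
rewrite integralE [in RHS]integralE funeposN funenegN.
have p0 : (0 <= \int[mu]_(x in D) g^\+ x)%E by exact: integral_ge0.
have n0 : (0 <= \int[mu]_(x in D) g^\- x)%E by exact: integral_ge0.
move: p0 n0; case: (\int[mu]_(x in D) g^\+ x)%E => [r| |]//;
  case: (\int[mu]_(x in D) g^\- x)%E => [s| |]//= _ _; rewrite ?oppr0//.
by rewrite opprB.
Qed.

Lemma cint_conj (f : T -> C) : cint mu D (fun x => conjc (f x)) = conjc (cint mu D f).
Proof.
rewrite /cint /=; under eq_Rintegral do rewrite Re_conjc.
under [X in Complex _ X = _]eq_Rintegral do rewrite Im_conjc.
by rewrite Rintegral_opp.
Qed.

Lemma cint_real (f : T -> C) : (forall x, complex.Im (f x) = 0) ->
  complex.Im (cint mu D f) = 0.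
Proof.
move=> f0 /=; under eq_Rintegral do rewrite f0.
by rewrite /Rintegral integral0.
Qed.

Lemma Re_cint_ge0 (f : T -> C) : (forall x, 0 <= complex.Re (f x)) ->
  0 <= complex.Re (cint mu D f).
Proof. by move=> f0; apply: Rintegral_ge0 => x _; exact: f0. Qed.

Lemma L2_conj (f : T -> C) : L2 mu D f -> L2 mu D (fun x => conjc (f x)).
Proof.
move=> [mR mI fin]; split.
- by under eq_fun do rewrite Re_conjc.
- under eq_fun do rewrite Im_conjc.
  exact: measurableT_comp mI.
- rewrite /L2norm2; under eq_integral do rewrite sqmod_conjc.
  exact: fin.
Qed.

Lemma L2norm2_conj (f : T -> C) : L2norm2 mu D (fun x => conjc (f x)) = L2norm2 mu D f.
Proof. by apply: eq_integral => x _; rewrite sqmod_conjc. Qed.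

End complex_integrals.

Section conjugation.
Variables (R : realType) (d : nat).
Notation C := R[i].
Notation E := 'rV[R]_d.
Implicit Types (w : set E) (u g : E -> C).

Lemma sobolev_cjf w u gu : sobolev w u gu -> sobolev w (cjf u) (fun i => cjf (gu i)).
Proof.
move=> [uL2 guP]; split; first exact: L2_conj.
move=> i; have [giL2 gi] := guP i; split; first exact: L2_conj.
have cjM v (h : E -> R) : vint w (fun x => cjf v x * (h x)%:C%C) =
    conjc (vint w (fun x => v x * (h x)%:C%C)).
  rewrite /vint -cint_conj; congr cint; apply/funext => x.
  rewrite rmorphM /=; congr (_ * _). by rewrite /= oppr0.
by move=> f fP; rewrite !cjM gi// rmorphN.
Qed.

(** Differentiability of the iterated derivatives is what lets the derivative
    operator, a total function, commute with the sign. *)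
Lemma smooth_opp (f : E -> R) : smooth f -> smooth (fun x => - f x).
Proof.
move=> fs s.
have -> : foldr (@pder R d) (fun x => - f x) s = (fun x => - foldr (@pder R d) f s x).
  elim: s => //= i s ->; apply/funext => x.
  by rewrite /pder deriveN//; exact: (fs s).2.
have [fc fd] := fs s; split.
  by move=> x; apply: continuousN; exact: fc.
by move=> i x; apply: derivableN; exact: fd.
Qed.

Lemma is_trace_cjf w u g : is_trace w u g -> is_trace w (cjf u) (cjf g).
Proof.
move=> [gL2 [f [gu [fs uW fu fgu fg]]]]; split; first exact: L2_conj.
exists (fun n => cjf (f n)), (fun i => cjf (gu i)); split.
- move=> n; have [fR fI] := fs n; split.
    rewrite (_ : (fun x => _) = (fun x => complex.Re (f n x)))//.
    by apply/funext => x; rewrite Re_conjc.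
  rewrite (_ : (fun x => _) = (fun x => - complex.Im (f n x))); first exact: smooth_opp.
  by apply/funext => x; rewrite Im_conjc.
- exact: sobolev_cjf.
- rewrite (_ : (fun n => _) = (fun n => L2norm2 (mu_vol R d) w (f n \- u)))//.
  apply/funext => n; rewrite -[RHS]L2norm2_conj; congr L2norm2; apply/funext => x.
  by rewrite /= rmorphB.
- move=> i.
  rewrite (_ : (fun n => _) = (fun n => L2norm2 (mu_vol R d) w (cpder i (f n) \- gu i)))//.
  apply/funext => n; rewrite -[RHS]L2norm2_conj; congr L2norm2; apply/funext => x.
  rewrite /= rmorphB /=; congr (_ - _); rewrite /cpder /=; congr Complex.
    by congr (pder i _ x); apply/funext => y; rewrite Re_conjc.
  rewrite (_ : (fun y => complex.Im (cjf (f n) y)) = (fun y => - complex.Im (f n y))).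
    by rewrite /pder deriveN//; exact: ((fs n).2 [::]).2.
  by apply/funext => y; rewrite Im_conjc.
- rewrite (_ : (fun n => _) = (fun n => L2norm2 (mu_surf R d) (bdry w) (f n \- g)))//.
  apply/funext => n; rewrite -[RHS]L2norm2_conj; congr L2norm2; apply/funext => x.
  by rewrite /= rmorphB.
Qed.

Lemma is_trace_inH1 w u g : is_trace w u g -> inH1 w u.
Proof. by move=> [_ [f [gu [_ uW _ _ _]]]]; exists gu. Qed.

Lemma inH1_cjf w u : inH1 w u -> inH1 w (cjf u).
Proof. by move=> [gu uW]; exists (fun i => cjf (gu i)); exact: sobolev_cjf. Qed.

Lemma inH12_cjf w g : inH12 w g -> inH12 w (cjf g).
Proof.
move=> [u [uH ug]]; exists (cjf u).
by split; [exact: inH1_cjf|exact: is_trace_cjf].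
Qed.

(** Every class in H^1 has a representative with a trace function, obtained from
    a representative of its abstract trace. *)
Lemma h1_trace_fun (kappa : R) w (V : H1_space kappa w) (X : H12_space V) (x : V) :
  exists u g, [/\ inH1 w u, inH12 w g, is_trace w u g, h1_cl V u = x &
    h12_trace X x = h12_cl X g].
Proof.
have [u [uH ux]] := h1_cl_onto x.
have [g [gH gx]] := h12_cl_onto (h12_trace X x).
have ug : is_trace w u g by apply/(h12_traceP X uH gH); rewrite ux gx.
by exists u, g; exact: And5 uH gH ug ux (esym gx).
Qed.

Lemma h12_trace_conj (kappa : R) w (V : H1_space kappa w) (X : H12_space V) (x : V) :
  h12_trace X (conj x) = conj (h12_trace X x).
Proof.
have [u [g [uH gH ug <- ->]]] := h1_trace_fun X x.
rewrite -h1_cl_conj// -h12_cl_conj//.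
by apply/(h12_traceP X (inH1_cjf uH) (inH12_cjf gH)); exact: is_trace_cjf.
Qed.

Lemma skeleton_restriction_conj (kappa : R) (Om : set E) (J : nat)
    (om : 'I_J -> set E) (VOm : H1_space kappa Om)
    (V : forall j, H1_space kappa (om j)) (X : forall j, H12_space (V j))
    (Y : H12_skeleton om VOm) (Rr : Y -> hprod X) :
  (forall g, inH12_skeleton Om om g -> forall j, Rr (sk_cl Y g) j = h12_cl (X j) g) ->
  forall v, Rr (conj v) = conj (Rr v).
Proof.
move=> RrP v; have [g [gS <-]] := sk_cl_onto v.
have [u [uH ug]] := gS.
have cgS : inH12_skeleton Om om (cjf g).
  exists (cjf u); split; first exact: inH1_cjf.
  by move=> j; exact/is_trace_cjf/ug.
apply/functional_extensionality_dep => j; rewrite -sk_cl_conj// RrP//=.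
rewrite h12_cl_conj ?RrP//; exists u; split; last exact: ug.
exact: is_trace_inH1 (ug j).
Qed.

(** The volume terms are integrals of real functions, and the boundary term is
    - i kappas times an integral of |tu|^2. *)
Lemma Im_helmholtz_form (kappa kappas : R) w S u gu tu : 0 <= kappas ->
  complex.Im (helmholtz_form kappa kappas w S u gu tu
    (cjf u) (fun i => cjf (gu i)) (cjf tu)) <= 0.
Proof.
move=> ks0; rewrite /helmholtz_form.
have cc (z : C) : complex.Im (z * conjc z) = 0 by case: z => x y /=; ring.
have vr : complex.Im (vint w (fun x => cvec_dot gu (fun i => cjf (gu i)) x
    - (kappa ^+ 2)%:C%C * u x * cjf u x)) = 0.
  apply: cint_real => x; rewrite /cvec_dot.
  have -> : \sum_i gu i x * cjf (gu i) x = (\sum_i cabs (gu i x) ^+ 2)%:C%C.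
    by rewrite rmorph_sum; apply: eq_bigr => i _; rewrite sqmodE.
  by rewrite -mulrA sqmodE -rmorphM -rmorphB.
have sr : complex.Im (sint S (fun x => tu x * cjf tu x)) = 0.
  by apply: cint_real => x; exact: cc.
have s0 : 0 <= complex.Re (sint S (fun x => tu x * cjf tu x)).
  by apply: Re_cint_ge0 => x; rewrite /cjf; case: (tu x) => y z /=; nra.
move: vr sr s0; set vi := vint _ _; set si := sint _ _.
case: vi => a1 a2 /= ->; case: si => b1 b2 /= -> b0.
nra.
Qed.

End conjugation.

(** * The convergence estimate *)

Theorem proposition6p4
  (R : realType) (d : nat) (d_gt0 : (0 < d)%N)
  (* geometry and data *)
  (Om : set 'rV[R]_d) (Om_bounded : bounded_set Om)
  (Om_lipschitz : lipschitz_open Om)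
  (J : nat) (om : 'I_J -> set 'rV[R]_d)
  (om_lipschitz : forall j, lipschitz_open (om j))
  (om_sub : forall j, om j `<=` Om)
  (om_disjoint : forall j k, j != k -> om j `&` om k = set0)
  (om_cover : closure Om = \bigcup_j closure (om j))
  (kappa kappas : R) (kappa_gt0 : 0 < kappa) (kappas_ge0 : 0 <= kappas)
  (f : 'rV[R]_d -> R[i]) (f_L2 : L2 (mu_vol R d) Om f)
  (* H^1(Om), H^1(om j), H^{1/2}(bdry (om j)), H^{1/2}(Sigma) *)
  (VOm : H1_space kappa Om) (V : forall j, H1_space kappa (om j))
  (X : forall j, H12_space (V j)) (Y : H12_skeleton om VOm)
  (* well-posedness of the global problem *)
  (a : VOm -> VOm -> R[i]) (a_form : is_global_form kappas a)
  (well_posed : (0 < inf_sup a)%E)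
  (* the operators A, B, T_+ and R *)
  (A : bop (@hnorm R (hprod V)) (@dnorm R (hprod V)))
  (A_form : forall (u : 'I_J -> 'rV[R]_d -> R[i]) gu tu v gv tv,
     (forall j, [/\ sobolev (om j) (u j) (gu j), sobolev (om j) (v j) (gv j),
                    is_trace (om j) (u j) (tu j) &
                    is_trace (om j) (v j) (tv j)]) ->
     A (fun j => h1_cl (V j) (u j)) (fun j => h1_cl (V j) (v j)) =
     \sum_j helmholtz_form kappa kappas (om j) (bdry Om `&` bdry (om j))
              (u j) (gu j) (tu j) (v j) (gv j) (tv j))
  (B : bop (@hnorm R (hprod V)) (@hnorm R (hprod X)))
  (B_trace : forall (u : hprod V) j, B u j = h12_trace (X j) (u j))
  (Tp : bop (@hnorm R (hprod X)) (@dnorm R (hprod X)))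
  (Tp_dtn : forall p q : hprod X,
     Tp p q = \sum_j h12_dtn (X j) (p j) (q j))
  (Rr : bop (@hnorm R Y) (@hnorm R (hprod X)))
  (Rr_restr : forall g, inH12_skeleton Om om g ->
     forall j, Rr (sk_cl Y g) j = h12_cl (X j) g)
  (* the impedance operator T *)
  (T : bop (@hnorm R (hprod X)) (@dnorm R (hprod X)))
  (T_diag : block_diagonal T) (T_adj : self_adjoint T)
  (T_pos : positive_definite T)
  (T_compact : compact_op (fun p => T p - Tp p))
  (* the inverses occurring in Pi, in S and in the skeleton equation exist *)
  (RTR_inv : boundedly_invertible (@hnorm R Y) (@dnorm R Y) (RTR T Rr))
  (AiBTB_inv : boundedly_invertible (@hnorm R (hprod V)) (@dnorm R (hprod V))
                 (AiBTB A B T))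
  (IdPiS_inv : bijective (Id_plus_Pi T Rr (scatter A B T)))
  (* the right-hand side *)
  (ell : dual (hprod V))
  (ell_f : forall v : 'I_J -> 'rV[R]_d -> R[i],
     (forall j, inH1 (om j) (v j)) ->
     ell (fun j => h1_cl (V j) (v j)) =
     \sum_j vint (om j) (fun x => f x * v j x))
  (* the approximation S_r *)
  (Sr : bop (@dnorm R (hprod X)) (@dnorm R (hprod X))) :
  let nrm := Tinv_norm T in
  let S := scatter A B T in
  let IdPiS := Id_plus_Pi T Rr S in
  let P := op_inv (Id_plus_Pi T Rr Sr) in
  let F := rhs A B T Rr ell in
  let gam := lower_bound nrm IdPiS in
  let sig := fun j => singular_value nrm j (fun p => S p - Sr p) in
  sig 1%N < gam ->
  forall (n : nat) (p0 pn : dual (hprod X)),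
    is_gmres_iterate nrm (fun p => P (IdPiS p)) (P F) p0 n pn ->
    F - IdPiS p0 != 0 ->
    nrm (F - IdPiS pn) / nrm (F - IdPiS p0) <=
    (2 + sig 1%N) / (gam - sig 1%N) *
    \prod_(1 <= j < n.+1)
      (sig j / gam * (1 + sig j / gam) * (1 - sig 1%N / gam)^-1).
Proof.
have Hc : hcomplete (hprod X) := hprod_complete (fun j => @h12_complete _ _ _ _ _ (X j)).
have Tp_dot (p q : hprod X) : dot p q = Tp p (conj q).
  by rewrite Tp_dtn; apply: eq_bigr => j _; rewrite h12_dotE.
have T_bij := impedance_bijective Hc T_adj T_pos Tp_dot T_compact.
have dP := dform_inner_product T_adj T_pos T_bij.
have dC := Tinv_complete Hc T_adj T_pos Tp_dot T_compact.
have Rr_conj := skeleton_restriction_conj Rr_restr.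
have B_conj (u : hprod V) : B (conj u) = conj (B u).
  apply: functional_extensionality_dep => j.
  by rewrite B_trace /= B_trace h12_trace_conj.
have A_diss (u : hprod V) : complex.Im (A u (conj u)) <= 0.
  have ufP j : exists q : ('rV[R]_d -> R[i]) * ('I_d -> 'rV[R]_d -> R[i])
      * ('rV[R]_d -> R[i]),
      [/\ sobolev (om j) q.1.1 q.1.2, is_trace (om j) q.1.1 q.2 &
          h1_cl (V j) q.1.1 = u j].
    have [v [g [[gv vW] _ vg vu _]]] := h1_trace_fun (X j) (u j).
    by exists (v, gv, g).
  have [q qP] := choice ufP.
  have uE : u = (fun j => h1_cl (V j) (q j).1.1).
    by apply: functional_extensionality_dep => j; have [_ _ ->] := qP j.
  have cuE : conj u = (fun j => h1_cl (V j) (cjf (q j).1.1)).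
    apply: functional_extensionality_dep => j; have [qs _ qu] := qP j.
    by rewrite h1_cl_conj ?qu//; exists (q j).1.2.
  rewrite cuE {1}uE (A_form _ (fun j => (q j).1.2) (fun j => (q j).2) _
    (fun j i => cjf ((q j).1.2 i)) (fun j => cjf (q j).2)).
    rewrite raddf_sum; apply: sumr_le0 => j _; exact: Im_helmholtz_form.
  move=> j; have [qs qt _] := qP j.
  exact: And4 qs (sobolev_cjf qs) qt (is_trace_cjf qt).
have [RTR_bij _] := RTR_inv; have [Z_bij _] := AiBTB_inv.
have [k k0 dk] := dnorm_equiv Hc T_adj T_pos Tp_dot T_compact.
have Sr_bl : bounded_linear (ip_norm (dform T)) (ip_norm (dform T)) Sr.
  have [Sr_lin [M SrM]] := bopP Sr; split=> //.
  exists (k * (`|M| * k)) => p; rewrite -!mulrA.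
  rewrite (le_trans (dk _).2)// ler_wpM2l ?(ltW k0)// (le_trans (SrM _))//.
  apply: (@le_trans _ _ (`|M| * dnorm p)); first by rewrite ler_wpM2r ?dnorm_ge0 ?ler_norm.
  by rewrite ler_wpM2l//; exact: (dk _).1.
rewrite /= (Tinv_normE T_bij) => sig_lt n p0 pn pn_gmres r0.
apply: (preconditioned_gmres_bound dP dC (lin_map_exchange RTR_bij) _
  (lin_map_scatter Z_bij) _ Sr_bl IdPiS_inv sig_lt pn_gmres r0).
- by move=> p; rewrite exchange_isometry.
- exact: scatter_contraction.
Qed.
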